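(* Let $I\subset R=k[x_0,\dots,x_n]$ be the ideal of a set $P_0,\dots,P_r$ of at most $n+1$ general double points in $\mathbb P^n$ (so $r+1\le n+1$). Then, for $q\ge 1$, the graded Betti numbers of $R/I$ are \[ \beta_{q,q+1}(R/I)=\binom{n-r+1}{q+1}\binom{q}{q-1}, \] \[ \beta_{q,q+2}(R/I)=(n-r)\sum_{i=0}^{r-1}(r-i)\binom{n-i-1}{q-1}+\sum_{i=0}^{r-2}\binom{r-i}{2}\binom{n-i-2}{q-1}, \] \[ \beta_{q,q+3}(R/I)=\binom{r+1}{2}\binom{n-1}{q-1}, \] $\beta_{0,0}(R/I)=1$, and all other graded Betti numbers are zero.
   Context: $k$ is a field; $R=k[x_0,\dots,x_n]$ is standard graded; $\beta_{i,j}(M)=\dim_k\operatorname{Tor}_i^R(k,M)_j$. A double point is a fat point of multiplicity $2$. The points $P_0,\dots,P_r$ are in general position (linearly independent); after a linear change of coordinates $P_i=[0:\cdots:0:1:0:\cdots:0]$ with the $1$ in the position of $x_i$, and the ideal is $I=\mathfrak p_0^{2}\cap\cdots\cap\mathfrak p_r^{2}$, where $\mathfrak p_i=(x_0,\dots,x_{i-1},x_{i+1},\dots,x_n)$. Binomial coefficients $\binom{a}{b}$ are zero for $b>a\ge 0$, and empty sums are zero. *)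

(* Defs.v *)
From HB Require Import structures.
From mathcomp Require Import all_boot all_order all_algebra.
From mathcomp Require Import ring_quotient boolp.
From mathcomp Require Import mpoly.

Set Implicit Arguments.
Unset Strict Implicit.
Unset Printing Implicit Defensive.

Import GRing.Theory Quotient.
Local Open Scope ring_scope.
Local Open Scope quotient_scope.

(** * Quotient of a module by a submodule

    ring_quotient.v gives the quotient of a Z-module by a subgroup, and its
    ring structure in the case of a proper ideal of a ring; here it is made
    into a module.  An ideal of [R] is a submodule of [R^o]. *)

Section QuotientModule.
Variables (R : nzRingType) (V : lmodType R) (S : submodClosed V).

(* [submodClosed], being defined over semirings, does not inherit from
   [zmodClosed]. *)
Definition subgroup_of : {pred V} := S.
HB.instance Definition _ := GRing.isZmodClosed.Build V subgroup_of
  (GRing.submod_closedB (submodClosedP S)).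

Definition quotmod : Type := quot subgroup_of.
HB.instance Definition _ := GRing.Zmodule.on quotmod.
HB.instance Definition _ := EqQuotient.on quotmod.
HB.instance Definition _ := ZmodQuotient.on quotmod.
Local Notation Q := quotmod.

Definition quot_scale (a : R) (x : Q) : Q :=
  \pi_Q (a *: repr x).

Lemma quot_scale_pi a v : quot_scale a (\pi v) = \pi_Q (a *: v).
Proof.
apply/eqP; rewrite -(idealrBE subgroup_of) -scalerBr.
suff : repr (\pi_Q v) - v \in subgroup_of by exact: (@rpredZ _ _ S).
by rewrite (idealrBE subgroup_of) reprK.
Qed.

Fact quot_scaleA a b x :
  quot_scale a (quot_scale b x) = quot_scale (a * b) x.
Proof.
elim/(@quotW _ Q): x => x.
by rewrite (quot_scale_pi b x) !quot_scale_pi scalerA.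
Qed.

Fact quot_scale1 : left_id 1 quot_scale.
Proof. by elim/(@quotW _ Q) => x; rewrite quot_scale_pi scale1r. Qed.

Fact quot_scaleDr : right_distributive quot_scale +%R.
Proof.
move=> a; elim/(@quotW _ Q) => x; elim/(@quotW _ Q) => y.
by rewrite -raddfD !quot_scale_pi scalerDr raddfD.
Qed.

Fact quot_scaleDl x : {morph quot_scale^~ x : a b / a + b}.
Proof.
by elim/(@quotW _ Q): x => x a b; rewrite !quot_scale_pi scalerDl raddfD.
Qed.

HB.instance Definition _ := GRing.Zmodule_isLmodule.Build R Q
  quot_scaleA quot_scale1 quot_scaleDr quot_scaleDl.

End QuotientModule.

(** * Ideals *)

Section Ideals.
Variable R : comNzRingType.

(* The ideal generated by an arbitrary subset of [R]. *)
Definition ideal_span (G : R -> Prop) : {pred R^o} := fun f =>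
  `[< exists s : seq (R * R),
        (forall p, p \in s -> G p.2) /\ f = \sum_(p <- s) p.1 * p.2 >].

Fact ideal_span_submod G : submod_closed (ideal_span G).
Proof.
split=> [|a f g]; first by apply/asboolP; exists [::]; rewrite big_nil.
move=> /asboolP [s [sG ->]] /asboolP [t [tG ->]]; apply/asboolP.
exists ([seq (a * p.1, p.2) | p <- s] ++ t); split=> [p|].
  by rewrite mem_cat => /orP[/mapP[p' /sG ? ->]|/tG].
rewrite big_cat big_map; congr (_ + _).
by rewrite [LHS]mulr_sumr; apply: eq_bigr => p _; rewrite mulrA.
Qed.

HB.instance Definition _ G :=
  GRing.isSubmodClosed.Build R R^o (ideal_span G) (ideal_span_submod G).

Definition ideal_mul (I J : {pred R}) : {pred R^o} :=
  ideal_span (fun h => exists f g, [/\ f \in I, g \in J & h = f * g]).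

Definition ideal_bigcap (T : Type) (I : T -> {pred R}) : {pred R^o} :=
  fun f => `[< forall t, f \in I t >].

Fact ideal_bigcap_submod T (I : T -> submodClosed R^o) :
  submod_closed (ideal_bigcap (fun t => I t)).
Proof.
split=> [|a f g]; first by apply/asboolP => t; exact: rpred0.
move=> /asboolP fI /asboolP gI; apply/asboolP => t.
by apply: rpredD; [apply: rpredZ; exact: fI | exact: gI].
Qed.

End Ideals.

(** * Tor and graded Betti numbers over [k[x_0, ..., x_(m-1)]] *)

Section GradedBetti.
Variables (k : fieldType) (m : nat).
Local Notation R := {mpoly k[m]}.

Definition homogz (d : int) (f : R) : Prop :=
  match d with Posz e => f \is e.-homog | Negz _ => f = 0 end.

(* The grading induced on [R / I]. *)
Definition quot_grading (I : submodClosed R^o) (d : int) (x : (quotmod I)) : Prop :=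
  exists2 f : R, homogz d f & x = \pi_(quotmod I) f.

(* [F_i] is the sum of the [R(- gdeg i a)] for [a < rank i]; row [a] of
   [diff i] holds the coordinates of the image of the [a]-th basis element of
   [F_(i+1)]. *)
Record free_complex := FreeComplex {
  rank : nat -> nat;
  gdeg : forall i, 'I_(rank i) -> int;
  diff : forall i, 'M[R]_(rank i.+1, rank i)
}.
Arguments gdeg F [i] a : rename.

(* [F_i (x)_R M] is the sum of the [M(- gdeg i a)], hence the finite functions
   from [I_(rank i)] to [M]; for [M = R^o] this is [F_i] itself. *)
Definition tensor (F : free_complex) (M : lmodType R) (i : nat) : Type :=
  {ffun 'I_(rank F i) -> M}.
HB.instance Definition _ F M i := GRing.Lmodule.on (tensor F M i).

Definition tensor_diff (F : free_complex) (M : lmodType R) (i : nat)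
    (v : tensor F M i.+1) : tensor F M i :=
  [ffun b => \sum_a diff F i a b *: v a].

Definition tensor_homog (F : free_complex) (M : lmodType R)
    (gr : int -> M -> Prop) (j : int) (i : nat) (v : tensor F M i) : Prop :=
  forall a, gr (j - gdeg F a) (v a).

Definition is_cycle (F : free_complex) (M : lmodType R) (i : nat) :
    tensor F M i -> Prop :=
  if i is i'.+1 then fun v => tensor_diff v = 0 else fun _ => True.

Definition augment (F : free_complex) (N : lmodType R)
    (eps : 'I_(rank F 0) -> N) (v : tensor F R^o 0) : N :=
  \sum_a (v a : R) *: eps a.

(* [... -> F_1 -> F_0 -> N -> 0] is exact, with maps of degree 0. *)
Record graded_free_resolution (N : lmodType R) (grN : int -> N -> Prop)
    (F : free_complex) (eps : 'I_(rank F 0) -> N) : Prop :=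
  GradedFreeResolution {
  diff_homog : forall i a b,
    homogz (gdeg F a - gdeg F b) (diff F i a b);
  eps_homog : forall a, grN (gdeg F a) (eps a);
  eps_surj : forall y, exists v, y = augment eps v;
  exact0 : forall v : tensor F R^o 0,
    augment eps v = 0 <-> exists w, v = tensor_diff w;
  exactS : forall i (v : tensor F R^o i.+1),
    tensor_diff v = 0 <-> exists w, v = tensor_diff w
}.

(* [dim_k (Z / B) = b], for k-subspaces [B] of [Z] of an R-module [V]. *)
Definition subquot_dim (V : lmodType R) (Z B : V -> Prop) (b : nat) : Prop :=
  exists e : 'I_b -> V,
    [/\ forall l, Z (e l),
        forall z, Z z -> exists c : 'I_b -> k,
          B (z - \sum_l (c l)%:MP *: e l)
      & forall c : 'I_b -> k,
          B (\sum_l (c l)%:MP *: e l) -> forall l, c l = 0].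

Definition homology_dim (F : free_complex) (M : lmodType R)
    (gr : int -> M -> Prop) (i : nat) (j : int) (b : nat) : Prop :=
  subquot_dim
    (fun v : tensor F M i => tensor_homog gr j v /\ is_cycle v)
    (fun v => exists2 w : tensor F M i.+1,
                tensor_homog gr j w & v = tensor_diff w)
    b.

(* [dim_k Tor_i^R(N, M)_j = b].  Tor is computed from a graded free resolution
   of its first argument; the value is required to be [b] for all of them, and
   the first conjunct keeps this from being vacuous. *)
Definition tor_dim (N : lmodType R) (grN : int -> N -> Prop)
    (M : lmodType R) (grM : int -> M -> Prop) (i : nat) (j : int) (b : nat) :
    Prop :=
  (exists F (eps : 'I_(rank F 0) -> N), graded_free_resolution grN eps) /\
  (forall F (eps : 'I_(rank F 0) -> N), graded_free_resolution grN eps ->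
     homology_dim F grM i j b).

Definition irrelevant_ideal : {pred R^o} :=
  ideal_span (fun f : R => exists i, f = 'X_i).
HB.instance Definition _ := GRing.SubmodClosed.on irrelevant_ideal.

(* [beta_{i,j}(M) = b]; the field [k] is the R-module [R / (x_0, ..., x_(m-1))]. *)
Definition graded_betti (M : lmodType R) (grM : int -> M -> Prop)
    (i : nat) (j : int) (b : nat) : Prop :=
  tor_dim (@quot_grading irrelevant_ideal) grM i j b.

End GradedBetti.

(** * Double points of projective space *)

Section DoublePoints.
Variables (k : fieldType) (m : nat).
Local Notation R := {mpoly k[m]}.

(* Homogeneous ideal of the point with homogeneous coordinates [a].  It is
   generated by the forms vanishing at [a], so that the definition is also
   right over finite fields. *)
Definition point_ideal (a : 'I_m -> k) : {pred R^o} :=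
  ideal_span (fun f : R => (exists d, f \is d.-homog) /\ f.@[a] = 0).

Definition double_point_ideal (a : 'I_m -> k) : {pred R^o} :=
  ideal_mul (point_ideal a) (point_ideal a).
HB.instance Definition _ a := GRing.SubmodClosed.on (double_point_ideal a).

(* The points are given by the rows of [P]. *)
Definition double_points_ideal (s : nat) (P : 'M[k]_(s, m)) : {pred R^o} :=
  ideal_bigcap (fun i => double_point_ideal (P i)).
HB.instance Definition _ s (P : 'M[k]_(s, m)) :=
  GRing.isSubmodClosed.Build R R^o (double_points_ideal P)
    (ideal_bigcap_submod (fun i => double_point_ideal (P i))).

(* [beta_{i,j}(R/I) = b] *)
Definition quot_betti (I : submodClosed R^o) (i : nat) (j : int) (b : nat) :
    Prop :=
  graded_betti (@quot_grading k m I) i j b.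

End DoublePoints.

(* Main.v *)
Require Import Defs.
From mathcomp Require Import all_boot all_order all_algebra.
From mathcomp Require Import ring_quotient boolp zify.
From mathcomp Require Import mpoly.

Set Implicit Arguments.
Unset Strict Implicit.
Unset Printing Implicit Defensive.

Import Order.TTheory GRing.Theory Quotient.
Local Open Scope ring_scope.
Local Open Scope quotient_scope.

(** A linear change of coordinates moves the points to coordinate points of
    projective space, and the ideal I to a monomial ideal: a monomial x^u lies in
    the square of the ideal of the i-th coordinate point if and only if
    |u| - u_i >= 2 ([double_point_idealE]).  So x^u lies in I if and only if this
    holds for all i <= r, and the minimal generators of I are
<<
      x_a x_b        r < a <= b
      x_i x_j x_l    i < j <= r, j < l
      x_i^2 x_j^2    i < j <= r
>>
    ([multiple_of_generators]).  Sort them by degree, then lexicographically.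
    This order has linear quotients: when g is reached, the ideal J of the earlier
    generators satisfies J : g = (x_t : t in S(g)) for a set S(g) of variables
    ([linear_quotients_generators]).  In degrees 2 and 3, with i the first variable
    of g, S(g) consists of the x_t with t > i such that t > r or x_t does not divide
    g; for x_i^2 x_j^2 it consists of all variables but x_i and x_j.

    An ideal with linear quotients has Betti numbers that can be read off from the
    sets S(g) ([hdim_linear_quotients]).  For g of degree d the exact sequence
<<
      0 -> R/(J : g)(-d) -> R/J -> R/(J + (g)) -> 0
>>
    gives a long exact sequence of Tor(k, -).  Its maps
    Tor_q(k, R/(J : g))_(j-d) -> Tor_q(k, R/J)_j vanish because, by induction, the
    source is zero unless j = d + q, whereas the target is zero unless j = q = 0 or
    j <= d + q - 1.  So Betti numbers add up: g contributes binom(#S(g), q - 1) to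
    beta_(q, d+q-1).  The same argument computes the Betti numbers
    binom(#S, q) of R/(x_t : t in S) that enter here ([hdim_vars]).  Summing over
    the generators ([sum_generators]) gives the three formulas.

    Tor is computed from an arbitrary graded free resolution F of k, as the homology
    of F modulo an ideal J.  A class modulo J is represented by a row vector of
    polynomials, so that cycles and boundaries are conditions of membership in J
    ([hdim]); the connecting maps then need no quotient modules.  The long exact
    sequence is [hdim_cone0] and [hdim_coneS], its starting point J = 0 is the
    exactness of F ([hdim0_0], [hdim0_vanishS]).  That k has a resolution at all is
    shown by adding the variables one at a time, taking mapping cones
    ([koszul_resolution]). *)

(** * Homogeneous parts of polynomials *)

Section Homogeneous.
Variables (k : fieldType) (m : nat).
Local Notation R := {mpoly k[m]}.
Implicit Types (f g : R) (z : int).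

Lemma homogzP z f :
  homogz z f <-> forall u, u \in msupp f -> (mdeg u)%:Z = z.
Proof.
case: z => e /=; first split=> [/dhomogP fe u /fe -> //|fe].
  by apply/dhomogP => u /fe [].
split=> [-> u|f0]; first by rewrite msupp0.
apply: msuppnil0; case E: (msupp f) => [//|u s].
by have := f0 u; rewrite E inE eqxx => /(_ isT).
Qed.

Lemma homogz0 z : homogz z (0 : R).
Proof. by apply/homogzP => u; rewrite msupp0. Qed.

Lemma homogzD z f g : homogz z f -> homogz z g -> homogz z (f + g).
Proof.
move=> /homogzP hf /homogzP hg; apply/homogzP => u.
by move=> /msuppD_le; rewrite mem_cat => /orP[/hf|/hg].
Qed.

Lemma homogzN z f : homogz z f -> homogz z (- f).
Proof.
by move=> /homogzP hf; apply/homogzP => u; rewrite (perm_mem (msuppN f)); apply: hf.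
Qed.

Lemma homogzM y z f g : homogz y f -> homogz z g -> homogz (y + z) (f * g).
Proof.
move=> /homogzP hf /homogzP hg; apply/homogzP => u /msuppM_le /allpairsP.
by case=> -[u1 u2] /= [/hf <- /hg <- ->]; rewrite mdegD PoszD.
Qed.

Lemma homogz_sum (I : Type) (s : seq I) (P : pred I) z (F : I -> R) :
  (forall i, P i -> homogz z (F i)) -> homogz z (\sum_(i <- s | P i) F i).
Proof.
by move=> hF; apply: big_ind => //; [apply: homogz0 | apply: homogzD].
Qed.

Lemma homogzC (c : k) : homogz 0 (c%:MP : R).
Proof.
apply/homogzP => u; rewrite msuppC; case: eqP => //= _.
by rewrite inE => /eqP ->; rewrite mdeg0.
Qed.

Lemma homogzMC z c f : homogz z f -> homogz z (c%:MP * f).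
Proof. by move=> /(homogzM (homogzC c)); rewrite add0r. Qed.

Lemma homogzX u : homogz (mdeg u)%:Z ('X_[u] : R).
Proof. by apply/homogzP => v /mem_msuppXP <-. Qed.

Lemma homogz0_const f : homogz 0 f -> f = (f@_0%MM)%:MP.
Proof.
move=> /homogzP f0; apply/mpolyP => u; rewrite mcoeffC.
have [->|u0] := eqVneq u 0%MM; first by rewrite mulr1.
rewrite mulr0; apply/memN_msupp_eq0/negP => /f0 /eqP.
by rewrite eqz_nat mdeg_eq0 (negbTE u0).
Qed.

Definition mfilter (P : pred 'X_{1..m}) f : R :=
  \sum_(u <- msupp f | P u) f@_u *: 'X_[u].

Lemma mcoeff_mfilter P f u : (mfilter P f)@_u = if P u then f@_u else 0.
Proof.
rewrite /mfilter raddf_sum /= big_mkcond /=.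
transitivity (\sum_(v <- msupp f) (if v == u then if P u then f@_u else 0 else 0)).
  apply: eq_bigr => v _; case: (eqVneq v u) => [->|vu].
    by case: (P u) => //; rewrite mcoeffZ mcoeffX eqxx mulr1.
  by case: (P v) => //; rewrite mcoeffZ mcoeffX (negbTE vu) mulr0.
rewrite -big_mkcond /=; have [uf|uf] := boolP (u \in msupp f).
  by rewrite -big_filter filter_pred1_uniq ?msupp_uniq // big_seq1.
rewrite big_seq_cond big1; first by rewrite memN_msupp_eq0 // if_same.
by move=> v /andP[vf /eqP vu]; rewrite -vu vf in uf.
Qed.

Lemma msupp_mfilter P f u : u \in msupp (mfilter P f) = P u && (u \in msupp f).
Proof. by rewrite !mcoeff_msupp mcoeff_mfilter; case: ifP => //; rewrite eqxx. Qed.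

Lemma mfilterD P f g : mfilter P (f + g) = mfilter P f + mfilter P g.
Proof.
apply/mpolyP => u; rewrite mcoeffD !mcoeff_mfilter mcoeffD.
by case: ifP => //; rewrite addr0.
Qed.

Lemma mfilter_sum P (I : Type) (s : seq I) (F : I -> R) :
  mfilter P (\sum_(i <- s) F i) = \sum_(i <- s) mfilter P (F i).
Proof.
apply: (big_morph (mfilter P) (mfilterD P)).
by apply/mpolyP => u; rewrite mcoeff_mfilter mcoeff0 if_same.
Qed.

Lemma mfilter_split P f : f = mfilter P f + mfilter (predC P) f.
Proof.
apply/mpolyP => u; rewrite mcoeffD !mcoeff_mfilter /=.
by case: (P u); rewrite ?addr0 ?add0r.
Qed.

Lemma mfilter_id P f : {subset msupp f <= P} -> mfilter P f = f.
Proof.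
move=> fP; apply/mpolyP => u; rewrite mcoeff_mfilter.
by case: ifPn => // uP; rewrite memN_msupp_eq0 //; apply: contra uP => /fP.
Qed.

Lemma mfilter_none P f : {subset msupp f <= predC P} -> mfilter P f = 0.
Proof.
move=> fP; apply/mpolyP => u; rewrite mcoeff_mfilter mcoeff0.
by case: ifP => // uP; rewrite memN_msupp_eq0 //; apply/negP => /fP /negP.
Qed.

Lemma homogz_mfilter z P f : homogz z f -> homogz z (mfilter P f).
Proof.
by move=> /homogzP hf; apply/homogzP => u; rewrite msupp_mfilter => /andP[_ /hf].
Qed.

Definition hpart z f : R := mfilter (fun u => (mdeg u)%:Z == z) f.

Lemma homogz_hpart z f : homogz z (hpart z f).
Proof. by apply/homogzP => u; rewrite /hpart msupp_mfilter => /andP[/eqP]. Qed.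

Lemma hpart_id z f : homogz z f -> hpart z f = f.
Proof. by move=> /homogzP hf; apply: mfilter_id => u /hf /eqP. Qed.

(** Multiplication by a form commutes with taking homogeneous parts; this is what
    makes a graded complex exact degree by degree once it is exact. *)
Lemma hpartM y z f g : homogz y f -> hpart (y + z) (f * g) = f * hpart z g.
Proof.
move=> hf; rewrite {1}(mfilter_split (fun u => (mdeg u)%:Z == z) g) mulrDr.
have /homogzP fg := homogzM hf (homogz_hpart z g).
rewrite /hpart mfilterD [X in X + _]mfilter_id; last by move=> u uf; apply/eqP/fg.
rewrite [X in _ + X]mfilter_none ?addr0 //.
move=> u /msuppM_le /allpairsP[[u1 u2] /= [u1f]].
rewrite (msupp_mfilter (predC _)) /=.
move=> /andP[u2z _] ->; rewrite inE /= mdegD PoszD.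
move/homogzP: hf => /(_ _ u1f) ->; apply: contra u2z => /eqP /addrI ->.
exact: eqxx.
Qed.

End Homogeneous.

(** * Dimensions of subquotients *)

Section Subquotients.
Variables (k : fieldType) (m : nat).
Local Notation R := {mpoly k[m]}.

(** The cycles and boundaries of a given degree are k-subspaces, but not
    R-submodules, of a free module. *)
Record kclosed (V : lmodType R) (P : V -> Prop) : Prop := KClosed {
  kclosed0 : P 0;
  kclosedD : forall u v, P u -> P v -> P (u + v);
  kclosedZ : forall (c : k) u, P u -> P (c%:MP *: u)
}.

Lemma kclosedN (V : lmodType R) (P : V -> Prop) u : kclosed P -> P u -> P (- u).
Proof.
move=> cP Pu; have := kclosedZ cP (- 1) Pu.
by rewrite (raddfN (@mpolyC m k)) /= scaleN1r.
Qed.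

Lemma kclosedB (V : lmodType R) (P : V -> Prop) u v :
  kclosed P -> P u -> P v -> P (u - v).
Proof. by move=> cP Pu Pv; apply: (kclosedD cP) => //; apply: kclosedN. Qed.

Lemma kclosed_comb (V : lmodType R) (P : V -> Prop) b (c : 'I_b -> k)
    (e : 'I_b -> V) :
  kclosed P -> (forall l, P (e l)) -> P (\sum_l (c l)%:MP *: e l).
Proof.
move=> cP Pe; apply: big_ind => [||l _]; first exact: (kclosed0 cP).
  exact: (kclosedD cP).
exact: (kclosedZ cP).
Qed.

Lemma subquot_dim_iff (V : lmodType R) (Z B Z' B' : V -> Prop) b :
  (forall v, Z v <-> Z' v) -> (forall v, B v <-> B' v) ->
  subquot_dim Z B b -> subquot_dim Z' B' b.
Proof.
move=> ZZ BB [e [eZ eG eI]]; exists e; split=> [l|z /ZZ /eG[c /BB cB]|c /BB].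
- exact/ZZ.
- by exists c.
- exact: eI.
Qed.

Lemma subquot_dim0 (V : lmodType R) (Z B : V -> Prop) :
  (forall z, Z z -> B z) -> subquot_dim Z B 0.
Proof.
move=> ZB; exists (fun _ => 0); split=> [[]//|z /ZB|c _ []//].
by exists (fun _ => 0); rewrite big_ord0 subr0.
Qed.

Lemma subquot_dim0_sub (V : lmodType R) (Z B : V -> Prop) z :
  subquot_dim Z B 0 -> Z z -> B z.
Proof. by case=> e [_ eG _] /eG[c]; rewrite big_ord0 subr0. Qed.

(** Additivity of dimension in a short exact sequence
      0 -> Z/B -> Z1/B1 -> Z2/B2 -> 0.
    The second map is given by a linear relation T rather than a function, because
    the snake map that it stands for involves the choice of a lift. *)
Lemma subquot_dim_extension (V W : lmodType R) (Z B Z1 B1 : V -> Prop)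
    (Z2 B2 : W -> Prop) (T : V -> W -> Prop) b b' :
    kclosed Z -> kclosed Z1 -> kclosed B1 -> kclosed Z2 -> kclosed B2 ->
    kclosed (fun p : V * W => T p.1 p.2) ->
    (forall z, Z z -> Z1 z) -> (forall z, Z z -> B1 z -> B z) ->
    (forall z, B z -> B1 z) ->
    (forall z, Z1 z -> exists2 t, Z2 t & T z t) ->
    (forall t, Z2 t -> exists2 z, Z1 z & T z t) ->
    (forall z, Z z -> T z 0) ->
    (forall z t, Z1 z -> T z t -> B2 t -> exists2 y, Z y & B1 (z - y)) ->
    (forall z t, Z1 z -> B1 z -> Z2 t -> T z t -> B2 t) ->
  subquot_dim Z B b -> subquot_dim Z2 B2 b' -> subquot_dim Z1 B1 (b + b').
Proof.
move=> cZ cZ1 cB1 cZ2 cB2 cT ZZ1 ZB1 BB1 TZ TZ2 T0 TB2 TB1.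
case=> e [eZ eG eI] [f [fZ fG fI]].
have /fin_all_exists2[w wZ wT] : forall l, exists2 z, Z1 z & T z (f l).
  by move=> l; apply/TZ2/fZ.
have Tcomb (c : 'I_b' -> k) :
    T (\sum_l (c l)%:MP *: w l) (\sum_l (c l)%:MP *: f l).
  apply: (big_ind2 (fun v t => T v t)) => [|x1 x2 y1 y2 h1 h2|l _].
  - exact: (kclosed0 cT).
  - exact: (kclosedD cT (u := (x1, x2)) (v := (y1, y2))).
  - exact: (kclosedZ cT (c l) (u := (w l, f l)) (wT l)).
(* The basis: the one of Z/B, followed by lifts of the one of Z2/B2. *)
pose h l := match split l with inl a => e a | inr a => w a end.
have hE (c : 'I_(b + b') -> k) : \sum_l (c l)%:MP *: h l =
    \sum_l (c (lshift b' l))%:MP *: e l + \sum_l (c (rshift b l))%:MP *: w l.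
  rewrite big_split_ord /=; congr (_ + _); apply: eq_bigr => l _; congr (_ *: _).
    by rewrite /h (unsplitK (inl l : 'I_b + 'I_b')).
  by rewrite /h (unsplitK (inr l : 'I_b + 'I_b')).
have TB v t v' t' : T v t -> T v' t' -> T (v - v') (t - t').
  by move=> h1 h2; apply: (kclosedB (u := (v, t)) (v := (v', t')) cT).
exists h; split=> [l|z z1|c].
- by rewrite /h; case: (split l) => a //; apply/ZZ1/eZ.
- have [t t2 zt] := TZ z z1; have [c' c'B] := fG t t2.
  pose z' := z - \sum_l (c' l)%:MP *: w l.
  have [||y yZ yB] := TB2 z' (t - \sum_l (c' l)%:MP *: f l) _ _ c'B.
  + by apply: kclosedB => //; apply: kclosed_comb.
  + exact: TB.
  have [c cB] := eG y yZ.
  exists (fun l => match split l with inl a => c a | inr a => c' a end).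
  rewrite hE (eq_bigr (fun l => (c l)%:MP *: e l)) => [|l _]; last first.
    by rewrite (unsplitK (inl l : 'I_b + 'I_b')).
  rewrite [X in _ - (_ + X)](eq_bigr (fun l => (c' l)%:MP *: w l)) => [|l _];
    last first.
    by rewrite (unsplitK (inr l : 'I_b + 'I_b')).
  have -> : z - (\sum_l (c l)%:MP *: e l + \sum_l (c' l)%:MP *: w l) =
      (z' - y) + (y - \sum_l (c l)%:MP *: e l).
    by rewrite /z' [in RHS]addrA subrK opprD addrAC addrA.
  by apply: (kclosedD cB1) => //; apply: BB1.
- rewrite hE => B1h.
  set v := \sum_l _ in B1h; set v' := \sum_l _ in B1h.
  have Zv : Z1 v by apply: kclosed_comb => // l; apply/ZZ1.
  have T0v : T v 0.
    rewrite -(_ : \sum_(l < b) (c (lshift b' l))%:MP *: (0 : W) = 0); last first.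
      by rewrite big1 // => l _; rewrite scaler0.
    apply: (big_ind2 (fun v t => T v t)) => [|x1 x2 y1 y2 h1 h2|l _].
    + exact: (kclosed0 cT).
    + exact: (kclosedD cT (u := (x1, x2)) (v := (y1, y2))).
    + exact: (kclosedZ cT (c (lshift b' l)) (u := (e l, 0)) (T0 _ (eZ l))).
  have c'0 : forall l, c (rshift b l) = 0.
    apply: fI; apply: TB1 _ B1h _ _.
    - by apply: (kclosedD cZ1) => //; apply: kclosed_comb.
    - exact: kclosed_comb.
    have := kclosedD cT (u := (v, 0)) (v := (v', _)) T0v (Tcomb _).
    by rewrite /= add0r.
  have v'0 : v' = 0.
    by rewrite /v' big1 // => l _; rewrite c'0 mpolyC0 scale0r.
  have c0 : forall l, c (lshift b' l) = 0.
    apply: eI; rewrite v'0 addr0 in B1h.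
    by apply: ZB1 B1h; apply: kclosed_comb.
  by move=> l; rewrite -(splitK l); case: (split l) => a /=.
Qed.

End Subquotients.

(** * Homology of a complex modulo an ideal *)

Section HomologyModulo.
Variables (k : fieldType) (m : nat).
Local Notation R := {mpoly k[m]}.

Record is_ideal (J : R -> Prop) : Prop := IsIdeal {
  ideal0 : J 0;
  idealD : forall f g, J f -> J g -> J (f + g);
  idealM : forall a f, J f -> J (a * f)
}.

Definition entries (J : R -> Prop) n (v : 'rV[R]_n) : Prop :=
  forall a, J (v 0 a).

Section Entries.
Variables (J : R -> Prop) (idJ : is_ideal J).

Lemma entries0 n : entries J (0 : 'rV_n).
Proof. by move=> a; rewrite mxE; apply: ideal0. Qed.

Lemma entriesD n (u v : 'rV_n) : entries J u -> entries J v -> entries J (u + v).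
Proof. by move=> hu hv a; rewrite mxE; apply: idealD. Qed.

Lemma entriesZ n c (v : 'rV_n) : entries J v -> entries J (c *: v).
Proof. by move=> hv a; rewrite mxE; apply: idealM. Qed.

Lemma entriesN n (v : 'rV_n) : entries J v -> entries J (- v).
Proof. by rewrite -scaleN1r; apply: entriesZ. Qed.

Lemma entriesB n (u v : 'rV_n) : entries J u -> entries J v -> entries J (u - v).
Proof. by move=> hu hv; apply: entriesD => //; apply: entriesN. Qed.

Lemma entries_mul n p (v : 'rV_n) (A : 'M_(n, p)) :
  entries J v -> entries J (v *m A).
Proof.
move=> hv b; rewrite mxE; apply: big_ind => [||a _].
- exact: ideal0.
- exact: idealD.
- by rewrite mulrC; apply: idealM.
Qed.

End Entries.

Variable F : free_complex k m.
Local Notation D i := (diff F i).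

Definition hvec (j : int) i (v : 'rV[R]_(rank F i)) : Prop :=
  forall a, homogz (j - gdeg a) (v 0 a).

Lemma hvec_kclosed j i : kclosed (@hvec j i).
Proof.
split=> [a|u v hu hv a|c u hu a]; rewrite mxE.
- exact: homogz0.
- exact: homogzD.
- exact: homogzMC.
Qed.

Lemma hvecZ d j i g (v : 'rV_(rank F i)) :
  homogz d g -> hvec (j - d) v -> hvec j (g *: v).
Proof.
move=> hg hv a; rewrite mxE.
by have := homogzM hg (hv a); rewrite addrA [d + _]addrC subrK.
Qed.

(** The vectors of degree j whose reduction modulo J is a cycle of F/JF. *)
Definition cycle_mod (J : R -> Prop) j i : 'rV[R]_(rank F i) -> Prop :=
  match i with
  | 0 => fun v => @hvec j 0 v
  | i'.+1 => fun v => @hvec j i'.+1 v /\ entries J (v *m D i')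
  end.

Definition boundary_mod (J : R -> Prop) j i (v : 'rV[R]_(rank F i)) : Prop :=
  exists2 w : 'rV_(rank F i.+1), hvec j w & entries J (v - w *m D i).

(** The dimension of H_i(F/JF)_j.  A vector with entries in J is a boundary, so
    nothing is lost by working with polynomials instead of their classes. *)
Definition hdim (J : R -> Prop) i (j : int) (b : nat) : Prop :=
  subquot_dim (@cycle_mod J j i) (@boundary_mod J j i) b.

Lemma cycle_mod_hvec J j i v : @cycle_mod J j i v -> hvec j v.
Proof. by case: i v => [|i] v // []. Qed.

Lemma hdim_iff J J' i j b :
  (forall f, J f <-> J' f) -> hdim J i j b -> hdim J' i j b.
Proof.
move=> JJ.
have E n (v : 'rV_n) : entries J v <-> entries J' v.
  by split=> h a; apply/JJ.
apply: subquot_dim_iff => v.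
  by case: i v => [|i] v //=; rewrite E.
by split=> -[w hw] /E wJ; exists w.
Qed.

Hypothesis D_homog : forall i a b, homogz (gdeg a - gdeg b) (D i a b).
Hypothesis DD0 : forall i, D i.+1 *m D i = 0.

Lemma hvec_mul j i (v : 'rV_(rank F i.+1)) : hvec j v -> hvec j (v *m D i).
Proof.
move=> hv b; rewrite mxE; apply: homogz_sum => a _.
by have := homogzM (hv a) (D_homog a b); rewrite addrA subrK.
Qed.

Section Ideal.
Variables (J : R -> Prop) (idJ : is_ideal J).

Lemma cycle_mod_kclosed j i : kclosed (@cycle_mod J j i).
Proof.
case: i => [|i]; first exact: hvec_kclosed.
split=> [|u v [hu uJ] [hv vJ]|c u [hu uJ]].
- by split; [exact: (kclosed0 (hvec_kclosed _ _)) | rewrite mul0mx; apply: entries0].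
- by split; [exact: (kclosedD (hvec_kclosed _ _)) | rewrite mulmxDl; apply: entriesD].
- by split; [exact: (kclosedZ (hvec_kclosed _ _)) | rewrite -scalemxAl; apply: entriesZ].
Qed.

Lemma boundary_mod_kclosed j i : kclosed (@boundary_mod J j i).
Proof.
split=> [|u v [w hw uw] [w' hw' vw]|c u [w hw uw]].
- exists 0; first exact: (kclosed0 (hvec_kclosed _ _)).
  by rewrite mul0mx subr0; apply: entries0.
- exists (w + w'); first exact: (kclosedD (hvec_kclosed _ _)).
  by rewrite mulmxDl opprD addrACA; apply: entriesD.
- exists (c%:MP *: w); first exact: (kclosedZ (hvec_kclosed _ _)).
  by rewrite -scalemxAl -scalerBr; apply: entriesZ.
Qed.

Lemma boundary_mod_entries j i (v : 'rV_(rank F i)) :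
  entries J v -> boundary_mod J j v.
Proof.
by exists 0; [exact: (kclosed0 (hvec_kclosed _ _)) | rewrite mul0mx subr0].
Qed.

Lemma boundary_mod_mul j i (w : 'rV_(rank F i.+1)) :
  hvec j w -> boundary_mod J j (w *m D i).
Proof. by exists w => //; rewrite subrr; apply: entries0. Qed.

End Ideal.

(** ** The long exact sequence of 0 -> R/(J : g)(-d) -> R/J -> R/(J + (g)) -> 0 *)

Section Cone.
Variables (J K J' : R -> Prop) (g : R) (d : int).
Hypotheses (idJ : is_ideal J) (idK : is_ideal K) (idJ' : is_ideal J').
Hypothesis JJ' : forall f, J f -> J' f.
Hypothesis J'g : J' g.
Hypothesis g_homog : homogz d g.
Hypothesis colon : forall f, K f <-> J (g * f).
Hypothesis J'split : forall z f, homogz z f -> J' f ->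
  exists u t, [/\ homogz z u, J u, homogz (z - d) t & f = u + g * t].

Lemma entries_split j i (v : 'rV_(rank F i)) : hvec j v -> entries J' v ->
  exists u t, [/\ hvec j u, entries J u, hvec (j - d) t & v = u + g *: t].
Proof.
move=> hv vJ'.
have /fin_all_exists[ut utP] a : exists ut : R * R,
    [/\ homogz (j - gdeg a) ut.1, J ut.1, homogz (j - d - gdeg a) ut.2
      & v 0 a = ut.1 + g * ut.2].
  have [u [t [hu uJ ht vE]]] := J'split (hv a) (vJ' a).
  by exists (u, t); rewrite addrAC.
exists (\row_a (ut a).1), (\row_a (ut a).2).
split=> [a|a|a|]; try by rewrite mxE; case: (utP a).
by apply/rowP => a; rewrite !mxE; case: (utP a).
Qed.

Lemma entries_colon n (v : 'rV_n) : entries K v <-> entries J (g *: v).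
Proof. by split=> h a; have := h a; rewrite mxE => /colon. Qed.

Lemma cycle_mod_sub j i v : @cycle_mod J j i v -> @cycle_mod J' j i v.
Proof. by case: i v => [|i] v //= [hv vJ]; split=> // a; apply/JJ'. Qed.

Lemma boundary_mod_sub j i v : @boundary_mod J j i v -> @boundary_mod J' j i v.
Proof. by case=> w hw vJ; exists w => // a; apply/JJ'. Qed.

Lemma entries_J'g n (t : 'rV_n) : entries J' (g *: t).
Proof. by move=> a; rewrite mxE mulrC; apply: idealM. Qed.

Lemma cycle_mod_colon j i t : @cycle_mod K (j - d) i t -> @cycle_mod J j i (g *: t).
Proof.
case: i t => [|i] t; first exact: hvecZ.
case=> ht /entries_colon tK; split; first exact: (hvecZ g_homog).
by rewrite -scalemxAl.
Qed.

(** Vanishing of the map H_i(F/KF)_(j-d) -> H_i(F/JF)_j of the long exact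
    sequence. *)
Definition mul_zero i j : Prop :=
  forall t, @cycle_mod K (j - d) i t -> boundary_mod J j (g *: t).

Lemma mul_zero_source i j : hdim K i (j - d) 0 -> mul_zero i j.
Proof.
move=> K0 t /(subquot_dim0_sub K0) [w hw tK].
exists (g *: w); first exact: (hvecZ g_homog).
by rewrite -scalemxAl -scalerBr; apply/entries_colon.
Qed.

Lemma mul_zero_target i j : hdim J i j 0 -> mul_zero i j.
Proof. by move=> J0 t /cycle_mod_colon /(subquot_dim0_sub J0). Qed.

(** Exactness at H_i(F/JF)_j: if v = d w + u + g t with u in J, then t is a cycle
    modulo K = J : g, so v is a boundary up to a multiple g t of a cycle. *)
Lemma boundary_mod_inj i j v : mul_zero i j ->
  @cycle_mod J j i v -> boundary_mod J' j v -> boundary_mod J j v.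
Proof.
move=> gz vZ [w hw vJ'].
have cB := boundary_mod_kclosed idJ j i.
have [|u [t [hu uJ ht vE]]] := entries_split _ vJ' (j := j).
  apply: (kclosedB (hvec_kclosed _ _)); last exact: hvec_mul.
  exact: cycle_mod_hvec vZ.
have tK : cycle_mod K (j - d) t.
  case: i v vZ w hw vJ' u hu uJ t ht vE {cB gz}
    => [|i] v vZ w hw vJ' u hu uJ t ht vE //=.
  split=> //; apply/entries_colon; rewrite scalemxAl.
  have -> : g *: t = v - w *m D i.+1 - u by rewrite vE addrC addKr.
  rewrite !mulmxBl -mulmxA DD0 mulmx0 subr0; case: vZ => _ vJ.
  by apply: (entriesB idJ) => //; apply: (entries_mul idJ).
rewrite -(subrK (w *m D i) v) vE; apply: (kclosedD cB).
  by apply: (kclosedD cB); [apply: boundary_mod_entries | apply: gz].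
exact: boundary_mod_mul.
Qed.

Lemma hdim_cone0 j b : mul_zero 0 j -> hdim J 0 j b -> hdim J' 0 j b.
Proof.
move=> gz; case=> e [eZ eG eI]; exists e; split=> // [z /eG[c cB]|c cB].
  by exists c; apply: boundary_mod_sub.
apply/eI/boundary_mod_inj => //.
exact: (kclosed_comb _ (cycle_mod_kclosed idJ j 0)).
Qed.

(** A cycle z modulo J' has boundary u + g t with u in J, and the class of t modulo
    K is its image under the connecting map.  The latter is onto because the next map
    is zero, and its kernel is the injective image of the homology modulo J. *)
Lemma hdim_coneS i j b b' : mul_zero i.+1 j -> mul_zero i j ->
  hdim J i.+1 j b -> hdim K i (j - d) b' -> hdim J' i.+1 j (b + b').
Proof.
move=> gz1 gz0.
apply: (subquot_dim_extension (T := fun v t => entries J (v *m D i - g *: t))).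
- exact: cycle_mod_kclosed.
- exact: cycle_mod_kclosed.
- exact: boundary_mod_kclosed.
- exact: cycle_mod_kclosed.
- exact: boundary_mod_kclosed.
- split=> [|[u t] [v s] /= h h'|c [u t] /= h].
  + by rewrite mul0mx scaler0 subr0; apply: entries0.
  + by rewrite mulmxDl scalerDr opprD addrACA; apply: entriesD.
  + by rewrite -scalemxAl scalerA [g * _]mulrC -scalerA -scalerBr; apply: entriesZ.
- exact: cycle_mod_sub.
- by move=> z; apply: boundary_mod_inj.
- exact: boundary_mod_sub.
- move=> z [hz zJ'].
  have [u [t [hu uJ ht zE]]] := entries_split (hvec_mul hz) zJ'.
  exists t; last by rewrite zE addrK.
  case: i z hz zJ' u hu uJ t ht zE {gz1 gz0} => [|i] z hz zJ' u hu uJ t ht zE //=.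
  split=> //; apply/entries_colon; rewrite scalemxAl.
  have -> : g *: t = z *m D i.+1 - u by rewrite zE addrC addKr.
  rewrite mulmxBl -mulmxA DD0 mulmx0 sub0r.
  by apply: entriesN => //; apply: entries_mul.
- move=> t tK; have [w hw tJ] := gz0 t tK; exists w.
    split=> //; rewrite -[_ *m _](subKr (g *: t)).
    by apply: entriesB => // [|a]; [apply: entries_J'g | apply: JJ'].
  by rewrite -opprB; apply: entriesN.
- by move=> z [hz zJ]; rewrite scaler0 subr0.
- move=> z t [hz zJ'] zt [s hs tK].
  have hgs : hvec j (g *: s) by apply: (hvecZ g_homog).
  exists (z - g *: s).
    split; first exact: (kclosedB (hvec_kclosed _ _)).
    have -> : (z - g *: s) *m D i = (z *m D i - g *: t) + g *: (t - s *m D i).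
      by rewrite mulmxBl scalerBr -scalemxAl addrA subrK.
    by apply: entriesD => //; apply/entries_colon.
  by rewrite subKr; apply: boundary_mod_entries => //; apply: entries_J'g.
- move=> z t [hz zJ'] [w hw zwJ'] tK zt.
  have [|u [s [hu uJ hs zE]]] := entries_split _ zwJ' (j := j).
    by apply: (kclosedB (hvec_kclosed _ _)) => //; apply: hvec_mul.
  exists s => //; apply/entries_colon.
  have -> : g *: (t - s *m D i) = u *m D i - (z *m D i - g *: t).
    rewrite -[z in RHS](subrK (w *m D i.+1)) zE !mulmxDl -mulmxA DD0 mulmx0.
    by rewrite addr0 opprB addrCA opprD addNKr scalerBr scalemxAl.
  by apply: entriesB => //; apply: entries_mul.
Qed.

End Cone.
End HomologyModulo.

(** * From polynomial vectors to tensor products *)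

Section Lifting.
Variables (k : fieldType) (m : nat).
Local Notation R := {mpoly k[m]}.
Variable F : free_complex k m.

Section Quotient.
Variable I : submodClosed R^o.
Local Notation M := (quotmod I).
Local Notation pi := (\pi_M : R^o -> M).

Lemma piZ (a : R) (f : R^o) : pi (a *: f) = a *: pi f.
Proof. by rewrite /GRing.scale /= quot_scale_pi. Qed.

Lemma pi_eq (f g : R^o) : pi f = pi g <-> f - g \in I.
Proof.
have E : (\pi_M f == \pi_M g) = (f - g \in I) by rewrite -(idealrBE (subgroup_of I)).
by rewrite -E; split=> /eqP.
Qed.

Lemma pi_eq0 (f : R^o) : pi f = 0 <-> f \in I.
Proof.
have p0 : pi 0 = 0 by rewrite raddf0.
by rewrite -p0; split=> [/pi_eq|fI]; [|apply/pi_eq]; rewrite subr0.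
Qed.

Definition tensor_pi i (v : 'rV[R]_(rank F i)) : tensor F M i :=
  [ffun a => pi (v 0 a)].

Lemma tensor_piD i : {morph @tensor_pi i : u v / u + v}.
Proof. by move=> u v; apply/ffunP => a; rewrite !ffunE mxE raddfD. Qed.

Lemma tensor_piZ i (c : R) v : @tensor_pi i (c *: v) = c *: tensor_pi v.
Proof. by apply/ffunP => a; rewrite !ffunE mxE piZ. Qed.

Lemma tensor_pi0 i : @tensor_pi i 0 = 0.
Proof. by apply/ffunP => a; rewrite !ffunE mxE raddf0. Qed.

Lemma tensor_piB i u v : @tensor_pi i (u - v) = tensor_pi u - tensor_pi v.
Proof. by rewrite tensor_piD -scaleN1r tensor_piZ scaleN1r. Qed.

Lemma tensor_pi_comb i b (c : 'I_b -> k) (e : 'I_b -> 'rV_(rank F i)) :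
  tensor_pi (\sum_l (c l)%:MP *: e l) = \sum_l (c l)%:MP *: tensor_pi (e l).
Proof.
rewrite (big_morph _ (@tensor_piD i) (tensor_pi0 i)).
by apply: eq_bigr => l _; rewrite tensor_piZ.
Qed.

Lemma tensor_pi_diff i (v : 'rV_(rank F i.+1)) :
  tensor_diff (tensor_pi v) = tensor_pi (v *m diff F i).
Proof.
apply/ffunP => b; rewrite !ffunE mxE raddf_sum /=; apply: eq_bigr => a _.
by rewrite ffunE -piZ; congr (pi _); rewrite mulrC.
Qed.

Lemma tensor_pi_eq i (u v : 'rV_(rank F i)) :
  tensor_pi u = tensor_pi v <-> entries (fun f => f \in I) (u - v).
Proof.
split=> [/ffunP E a|E]; first by have := E a; rewrite !ffunE !mxE => /pi_eq.
by apply/ffunP => a; rewrite !ffunE; apply/pi_eq; have := E a; rewrite !mxE.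
Qed.

Lemma tensor_homog_lift j i (x : tensor F M i) :
  tensor_homog (@quot_grading k m I) j x <->
    exists2 v : 'rV_(rank F i), hvec j v & x = tensor_pi v.
Proof.
split=> [/fin_all_exists2[v hv xv]|[v hv -> a]]; last first.
  by exists (v 0 a); rewrite ?ffunE.
exists (\row_a v a) => [a|]; first by rewrite mxE.
by apply/ffunP => a; rewrite ffunE mxE.
Qed.

(** Cycles and boundaries of F (x) R/I are the images of those modulo I. *)
Lemma homology_dim_quot i j b :
  hdim F (fun f => f \in I) i j b ->
  homology_dim F (@quot_grading k m I) i j b.
Proof.
have Bv (v : 'rV_(rank F i)) : boundary_mod (fun f => f \in I) j v <->
    exists2 w : tensor F M i.+1, tensor_homog (@quot_grading k m I) j w &
      tensor_pi v = tensor_diff w.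
  split=> [[w hw vw]|[_ /tensor_homog_lift[w hw ->]]].
    exists (tensor_pi w); first by apply/tensor_homog_lift; exists w.
    by rewrite tensor_pi_diff; apply/tensor_pi_eq.
  by rewrite tensor_pi_diff => /tensor_pi_eq vw; exists w.
have Zv (v : 'rV_(rank F i)) : hvec j v ->
    cycle_mod (fun f => f \in I) j v <-> is_cycle (tensor_pi v).
  case: i v {Bv} => [|i] v hv //=; rewrite tensor_pi_diff -(tensor_pi0 i).
  split=> [[_ vI]|/tensor_pi_eq].
    by apply/tensor_pi_eq; rewrite subr0.
  by rewrite subr0.
case=> e [eZ eG eI]; exists (fun l => tensor_pi (e l)); split=> [l|z [zh zc]|c].
- have hl := cycle_mod_hvec (eZ l).
  by split; [apply/tensor_homog_lift; exists (e l) | apply/Zv].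
- have [v hv zE] := iffLR (tensor_homog_lift _ _) zh.
  have [|c cB] := eG v; first by apply/Zv => //; rewrite -zE.
  by exists c; rewrite zE -tensor_pi_comb -tensor_piB; apply/Bv.
- by rewrite -tensor_pi_comb => /Bv /eI.
Qed.

End Quotient.

(** * The homology of a resolution of the ground field *)

Section Resolution.
Local Notation N := (quotmod (@irrelevant_ideal k m)).
Local Notation piN := (\pi_N : R^o -> N).
Variable eps : 'I_(rank F 0) -> N.
Hypothesis res : graded_free_resolution (@quot_grading k m (@irrelevant_ideal k m)) eps.

Definition to_tensor i (v : 'rV[R]_(rank F i)) : tensor F R^o i := [ffun a => v 0 a].

Lemma to_tensor_surj i (x : tensor F R^o i) : exists v, x = to_tensor v.
Proof. by exists (\row_a x a); apply/ffunP => a; rewrite ffunE mxE. Qed.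

Lemma to_tensor_inj i : injective (@to_tensor i).
Proof. by move=> u v /ffunP E; apply/rowP => a; have := E a; rewrite !ffunE. Qed.

Lemma to_tensor_diff i (v : 'rV_(rank F i.+1)) :
  tensor_diff (to_tensor v) = to_tensor (v *m diff F i).
Proof.
apply/ffunP => b; rewrite !ffunE mxE; apply: eq_bigr => a _.
by rewrite ffunE; apply: mulrC.
Qed.

Lemma resolution_exactS i (v : 'rV_(rank F i.+1)) :
  v *m diff F i = 0 <-> exists w, v = w *m diff F i.+1.
Proof.
have T0 : to_tensor (0 : 'rV_(rank F i)) = 0.
  by apply/ffunP => a; rewrite !ffunE mxE.
split=> [v0|[w ->]].
  have /(exactS res)[x] : tensor_diff (to_tensor v) = 0 by rewrite to_tensor_diff v0.
  have [w ->] := to_tensor_surj x; rewrite to_tensor_diff => /to_tensor_inj ->.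
  by exists w.
apply: (@to_tensor_inj i); rewrite T0 -to_tensor_diff; apply/(exactS res).
by exists (to_tensor w); rewrite to_tensor_diff.
Qed.

Lemma resolution_diff2 i : diff F i.+1 *m diff F i = 0.
Proof.
apply/row_matrixP => a; rewrite row_mul row0; apply/resolution_exactS.
by exists (delta_mx 0 a); rewrite rowE.
Qed.

Lemma resolution_exact0 (v : 'rV_(rank F 0)) :
  augment eps (to_tensor v) = 0 <-> exists w, v = w *m diff F 0.
Proof.
rewrite (exact0 res); split=> [[x]|[w ->]].
  have [w ->] := to_tensor_surj x; rewrite to_tensor_diff => /to_tensor_inj ->.
  by exists w.
by exists (to_tensor w); rewrite to_tensor_diff.
Qed.

(** The part of degree j of a vector: taking it turns a preimage under a
    differential into a homogeneous one. *)
Definition vpart j i (v : 'rV[R]_(rank F i)) : 'rV[R]_(rank F i) :=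
  \row_a hpart (j - gdeg a) (v 0 a).

Lemma hvec_vpart j i (v : 'rV_(rank F i)) : hvec j (vpart j v).
Proof. by move=> a; rewrite mxE; apply: homogz_hpart. Qed.

Lemma vpart_id j i (v : 'rV_(rank F i)) : hvec j v -> vpart j v = v.
Proof. by move=> hv; apply/rowP => a; rewrite mxE hpart_id. Qed.

Lemma vpart_mul j i (v : 'rV_(rank F i.+1)) :
  vpart j (v *m diff F i) = vpart j v *m diff F i.
Proof.
apply/rowP => b; rewrite !mxE /hpart mfilter_sum; apply: eq_bigr => a _.
rewrite mxE mulrC -/(hpart _ _).
have := hpartM (j - gdeg a) (v 0 a) (diff_homog res a b).
by rewrite [_ + (j - _)]addrC addrA subrK => ->; rewrite mulrC.
Qed.

Lemma hdim0_vanishS i j : hdim F (fun f => f = 0) i.+1 j 0.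
Proof.
apply: subquot_dim0 => v [hv v0].
have /resolution_exactS[w vE] : v *m diff F i = 0.
  by apply/rowP => b; rewrite v0 mxE.
exists (vpart j w); first exact: hvec_vpart.
by rewrite -vpart_mul -vE vpart_id // => a; rewrite subrr mxE.
Qed.

Lemma irrelevantE (f : R) : f \in @irrelevant_ideal k m <-> f@_0%MM = 0.
Proof.
split=> [/asboolP[s [sX ->]]|f0].
  rewrite raddf_sum /= big_seq big1 // => p /sX[i ->].
  by rewrite (rmorphM (mcoeff 0%MM)) /= mcoeffX mnm1_eq0 mulr0.
rewrite (mpolyE f) big_seq; apply: (@rpred_sum _ (@irrelevant_ideal k m)) => u uf.
have /existsP[i ui] : [exists i, u i != 0%N].
  rewrite -[X in is_true X]negbK negb_exists; apply/negP => /forallP u0.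
  move: uf; suff -> : u = 0%MM by rewrite mcoeff_msupp f0 eqxx.
  by apply/mnmP => i; rewrite mnm0E; apply/eqP; have := u0 i; rewrite negbK.
apply/asboolP; exists [:: (f@_u *: 'X_[u - U_(i)], 'X_i)].
rewrite big_seq1 /= -scalerAl -mpolyXD submK ?lep1mP //; split=> // p.
by rewrite inE => /eqP ->; exists i.
Qed.

Lemma homog_irrelevant (z : int) (f : R) :
  z != 0 -> homogz z f -> f \in @irrelevant_ideal k m.
Proof.
move=> z0 /homogzP hf; apply/irrelevantE/memN_msupp_eq0.
by apply: contra z0 => /hf <-; rewrite mdeg0.
Qed.

(** The augmentation lifts to a graded map to R, since each eps a is the class of a
    form. *)
Lemma augment_repr (v : 'rV_(rank F 0)) :
  exists2 f : R, augment eps (to_tensor v) = piN f &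
    forall j, augment eps (to_tensor (vpart j v)) = piN (hpart j f).
Proof.
have /fin_all_exists2[f hf fE] := eps_homog res.
have E (u : 'rV_(rank F 0)) :
    augment eps (to_tensor u) = piN (\sum_a u 0 a * f a).
  rewrite /augment raddf_sum /=; apply: eq_bigr => a _.
  by rewrite ffunE fE -piZ.
exists (\sum_a v 0 a * f a) => [|j]; rewrite E //; congr (piN _).
rewrite /hpart mfilter_sum; apply: eq_bigr => a _.
by rewrite mxE mulrC -(hpartM _ _ (hf a)) addrC subrK mulrC.
Qed.

Lemma augmentB (u v : 'rV_(rank F 0)) :
  augment eps (to_tensor (u - v)) =
  augment eps (to_tensor u) - augment eps (to_tensor v).
Proof.
rewrite /augment -sumrB; apply: eq_bigr => a _.
by rewrite !ffunE mxE mxE scalerBl.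
Qed.

Lemma augmentZ (c : R) (v : 'rV_(rank F 0)) :
  augment eps (to_tensor (c *: v)) = c *: augment eps (to_tensor v).
Proof.
rewrite /augment scaler_sumr; apply: eq_bigr => a _.
by rewrite !ffunE mxE scalerA.
Qed.

Lemma augment_ker j (v : 'rV_(rank F 0)) : hvec j v ->
  augment eps (to_tensor v) = 0 <-> boundary_mod (fun f => f = 0) j v.
Proof.
move=> hv; rewrite resolution_exact0; split=> [[w vE]|[w _ vw]].
  exists (vpart j w); first exact: hvec_vpart.
  by rewrite -vpart_mul -vE vpart_id // => a; rewrite subrr mxE.
exists w; apply/rowP => a; apply/eqP; rewrite -subr_eq0.
by have := vw a; rewrite !mxE => ->.
Qed.

(** In degree 0 the homology of F is R modulo the irrelevant ideal, that is, k in
    degree 0.  A basis is the degree 0 part of a vector that augments to 1. *)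
Lemma hdim0_0 j : hdim F (fun f => f = 0) 0 j (j == 0).
Proof.
have [->|j0] := eqVneq j 0; last first.
  apply: subquot_dim0 => v hv; apply/augment_ker => //.
  have [f _ fE] := augment_repr v; rewrite -(vpart_id hv) fE; apply/pi_eq0.
  exact: homog_irrelevant j0 (homogz_hpart _ _).
have [x] := eps_surj res (piN 1).
have [v ->] := to_tensor_surj x => {x}.
have [f -> /(_ 0) fE] := augment_repr v => /pi_eq /irrelevantE.
rewrite mcoeffB mcoeff1 eqxx => /eqP; rewrite subr_eq0 => /eqP f1.
have {f1}fE : augment eps (to_tensor (vpart 0 v)) = piN 1.
  rewrite fE; congr (piN _).
  by rewrite (homogz0_const (homogz_hpart 0 f)) mcoeff_mfilter mdeg0 -f1 mpolyC1.
have hv := hvec_vpart 0 v; move: (vpart 0 v) hv fE => {}v hv vE.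
exists (fun _ => v); split=> // [z hz|c].
  have [h _ /(_ 0)] := augment_repr z; rewrite (vpart_id hz).
  rewrite (homogz0_const (homogz_hpart 0 h)); set c := _@__ => fE.
  exists (fun _ => c); rewrite big_ord1; apply/augment_ker.
    apply: (kclosedB (hvec_kclosed _ _ _)) => //.
    exact: (kclosedZ (hvec_kclosed _ _ _)).
  by rewrite augmentB augmentZ fE vE -piZ /GRing.scale /= mulr1 subrr.
rewrite big_ord1 => /augment_ker; rewrite augmentZ vE -piZ.
have hc := kclosedZ (hvec_kclosed F 0 0) (c ord0) hv.
move=> /(_ hc) /pi_eq0 /irrelevantE.
rewrite /GRing.scale /= mulr1 mcoeffC eqxx mulr1 => c0 l.
by rewrite ord1.
Qed.

End Resolution.
End Lifting.

(** * The Koszul resolution, as an iterated mapping cone *)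

Section MappingCone.
Variables (k : fieldType) (m : nat).
Local Notation R := {mpoly k[m]}.
Implicit Types (F : free_complex k m) (J : R -> Prop).

(** F with the augmentation e is a graded free resolution of R/J.  The augmentation
    takes values in R, so that exactness is again a condition of membership in J. *)
Record resolves J F (e : 'cV[R]_(rank F 0)) : Prop := Resolves {
  resolves_diff : forall i a b, homogz (gdeg a - gdeg b) (diff F i a b);
  resolves_eps : forall a, homogz (gdeg a) (e a 0);
  resolves_surj : exists v : 'rV_(rank F 0), J ((v *m e) 0 0 - 1);
  resolves_exact0 : forall v : 'rV_(rank F 0),
    J ((v *m e) 0 0) <-> exists w, v = w *m diff F 0;
  resolves_exactS : forall i (v : 'rV_(rank F i.+1)),
    v *m diff F i = 0 <-> exists w, v = w *m diff F i.+1
}.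

(** F shifted by one place, with 0 in front: the summand that the mapping cone adds
    to F. *)
Definition prank F i : nat := if i is i'.+1 then rank F i' else 0.

Definition pgdeg F i : 'I_(prank F i) -> int :=
  match i with 0 => fun _ => 0 | i'.+1 => fun a => gdeg a end.

Definition pdiff F i : 'M[R]_(prank F i.+1, prank F i) :=
  match i with 0 => 0 | i'.+1 => diff F i' end.

(** The cone of multiplication by x on F, with differential
    (u, w) |-> (d u + x w, - d w). *)
Definition mapping_cone F (x : R) (d : int) : free_complex k m :=
  @FreeComplex k m (fun i => rank F i + prank F i)%N
    (fun i a => match split a with inl a' => gdeg a' | inr a' => pgdeg a' + d end)
    (fun i => block_mx (diff F i) 0 (x%:M : 'M_(prank F i.+1, rank F i)) (- pdiff F i)).

Section Exactness.
Variables (J J' : R -> Prop) (F : free_complex k m) (e : 'cV[R]_(rank F 0)).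
Variables (x : R) (d : int).
Hypotheses (idJ : is_ideal J) (res : resolves J e) (x_homog : homogz d x).
Hypothesis x_reg : forall f, J (x * f) -> J f.
Hypothesis J'E : forall f, J' f <-> exists u t, J u /\ f = u + x * t.
Local Notation D i := (diff F i).

Lemma cone_mul i (u : 'rV_(rank F i.+1)) (w : 'rV_(rank F i)) :
  (row_mx u w : 'rV_(rank F i.+1 + prank F i.+1)) *m diff (mapping_cone F x d) i =
  row_mx (u *m D i + x *: w) (- (w *m pdiff F i)).
Proof. by rewrite mul_row_block mulmx0 add0r mulmxN mul_mx_scalar. Qed.

Lemma resolves_diff2 i : D i.+1 *m D i = 0.
Proof.
apply/row_matrixP => a; rewrite row_mul row0; apply/(resolves_exactS res).
by exists (delta_mx 0 a); rewrite rowE.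
Qed.

Lemma pdiff2 i : pdiff F i.+1 *m pdiff F i = 0.
Proof. by case: i => [|i] /=; [rewrite mulmx0 | apply: resolves_diff2]. Qed.

(** If d u + x w = 0 and d w = 0 then w = d w', in the lowest degree because x is
    regular modulo J; then u + x w' is a cycle d u', and (u, w) is the image of
    (u', - w'). *)
Lemma cone_exactS i (v : 'rV_(rank (mapping_cone F x d) i.+1)) :
  v *m diff (mapping_cone F x d) i = 0 <->
    exists w, v = w *m diff (mapping_cone F x d) i.+1.
Proof.
rewrite -[v]hsubmxK; move: (lsubmx v) (rsubmx v) => u w {v}; split; last first.
  case=> v; rewrite -[v]hsubmxK; move: (lsubmx v) (rsubmx v) => u' w' {v}.
  rewrite cone_mul => /eq_row_mx[-> ->]; rewrite cone_mul mulmxDl -mulmxA.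
  rewrite resolves_diff2 mulmx0 add0r -scalemxAl scalerN subrr.
  by rewrite mulNmx opprK -mulmxA pdiff2 mulmx0 row_mx0.
rewrite cone_mul -[0 in X in X -> _](row_mx0 _ _ (rank F i) (prank F i)).
move=> /eq_row_mx[uw /eqP]; rewrite oppr_eq0 => /eqP wD.
have [w' wE] : exists w' : 'rV_(rank F i.+1), w = w' *m D i.
  case: i u w uw wD => [|i] u w uw wD; last exact/(resolves_exactS res).
  apply/(resolves_exact0 res)/x_reg.
  have : J ((- u *m D 0 *m e) 0 0) by apply/(resolves_exact0 res); exists (- u).
  have -> : - u *m D 0 = x *: w by rewrite mulNmx -[_ *: _](addKr (u *m D 0)) uw addr0.
  by rewrite -scalemxAl mxE.
have /(resolves_exactS res)[u' uE] : (u + x *: w') *m D i = 0.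
  by rewrite mulmxDl -scalemxAl -wE.
exists (row_mx u' (- w') : 'rV_(_ + prank F i.+2)); rewrite cone_mul -uE.
by rewrite scalerN addrK mulNmx opprK wE.
Qed.

(** A resolution of R/J gives one of R/(J + (x)) if x is regular on R/J. *)
Lemma resolves_cone :
  @resolves J' (mapping_cone F x d) (col_mx e (0 : 'M_(0, 1))).
Proof.
split.
- move=> i a b; rewrite -(splitK a) -(splitK b).
  move: (split a) (split b) => {}a {}b; rewrite /= !unsplitK.
  case: a => a; case: b => b /=; rewrite ?block_mxEul ?block_mxEur
    ?block_mxEdl ?block_mxEdr.
  + exact: (resolves_diff res).
  + by rewrite mxE; apply: homogz0.
  + rewrite mxE; case: eqP => [->|_]; last exact: homogz0.
    by rewrite mulr1n addrC addKr.
  + rewrite mxE opprD addrACA subrr addr0; apply: homogzN.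
    by case: i a b => [|i] a b; [case: b | apply: (resolves_diff res)].
- move=> a; rewrite -(splitK a); move: (split a) => {}a; rewrite /= unsplitK.
  by case: a => [a|[]//]; rewrite /= col_mxEu; apply: (resolves_eps res).
- have [v vJ] := resolves_surj res; exists (row_mx v 0).
  rewrite mul_row_col mulmx0 addr0; apply/J'E; exists ((v *m e) 0 0 - 1), 0.
  by rewrite mulr0 addr0.
- move=> v; rewrite -[v]hsubmxK; move: (lsubmx v) (rsubmx v) => u w {v}.
  rewrite mul_row_col mulmx0 addr0 J'E; split=> [[j [t [jJ uE]]]|[v]]; last first.
    rewrite -[v]hsubmxK; move: (lsubmx v) (rsubmx v) => u' w' {v}.
    rewrite cone_mul => /eq_row_mx[-> _].
    exists ((u' *m D 0 *m e) 0 0), ((w' *m e) 0 0); split.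
      by apply/(resolves_exact0 res); exists u'.
    by rewrite mulmxDl mxE -scalemxAl [in X in _ + X = _]mxE.
  have [v vJ] := resolves_surj res.
  have /(resolves_exact0 res)[u' u'E] : J (((u - (x * t) *: v) *m e) 0 0).
    have -> : ((u - (x * t) *: v) *m e) 0 0 = j + - (x * t) * ((v *m e) 0 0 - 1).
      by rewrite mulmxBl mxE uE -scalemxAl !mxE mulrBr mulr1 mulNr opprK addrA addrAC.
    by apply: (idealD idJ) => //; apply: (idealM idJ).
  exists (row_mx u' (t *: v)); rewrite cone_mul -u'E scalerA subrK.
  by congr (row_mx u _); apply/rowP => -[].
- exact: cone_exactS.
Qed.

End Exactness.
End MappingCone.

(** * Monomial ideals *)

Section MonomialIdeals.
Variables (k : fieldType) (m : nat).
Local Notation R := {mpoly k[m]}.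
Implicit Types (G : seq 'X_{1..m}) (g u : 'X_{1..m}).

Definition multiple_of G u : bool := has (fun g => g <= u)%MM G.

Definition mon_ideal G (f : R) : Prop := forall u, u \in msupp f -> multiple_of G u.

Lemma multiple_ofDl G u v : multiple_of G v -> multiple_of G (u + v)%MM.
Proof.
by case/hasP => g gG gu; apply/hasP; exists g => //; apply: lepm_trans gu (lem_addl _ _).
Qed.

Lemma mon_ideal_is_ideal G : is_ideal (mon_ideal G).
Proof.
split=> [u|f g hf hg u|a f hf u].
- by rewrite msupp0.
- by move=> /msuppD_le; rewrite mem_cat => /orP[/hf|/hg].
- by move=> /msuppM_le /allpairsP[[u1 u2] /= [_ /hf + ->]]; apply: multiple_ofDl.
Qed.

Lemma mon_ideal_nil f : mon_ideal [::] f <-> f = 0.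
Proof.
split=> [f0|-> u]; last by rewrite msupp0.
apply: msuppnil0; case E: (msupp f) => [//|u s].
by have := f0 u; rewrite E inE eqxx => /(_ isT).
Qed.

Lemma mem_msuppXM g (f : R) u : ((g + u)%MM \in msupp ('X_[g] * f)) = (u \in msupp f).
Proof. by rewrite !mcoeff_msupp mulrC mcoeffMX. Qed.

Lemma mon_idealXM G g (f : R) :
  mon_ideal G ('X_[g] * f) <-> forall u, u \in msupp f -> multiple_of G (g + u)%MM.
Proof.
split=> [h u uf|h u]; first by apply: h; rewrite mem_msuppXM.
rewrite mulrC => uf; have := uf; rewrite (perm_mem (msuppMX _ _)) => /mapP[v vf ->].
exact: h.
Qed.

(** The monomials of f outside the ideal of G are multiples of g; collecting them
    keeps degrees. *)
Lemma mon_ideal_rcons_split G g (f : R) : mon_ideal (rcons G g) f ->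
  exists u t : R, [/\ mon_ideal G u, f = u + 'X_[g] * t &
    forall z, homogz z f -> homogz z u /\ homogz (z - (mdeg g)%:Z) t].
Proof.
move=> fG; pose h := mfilter (predC (multiple_of G)) f.
have hgu u : u \in msupp h -> (g <= u)%MM.
  rewrite (msupp_mfilter (predC _)) /= => /andP[uG /fG].
  by rewrite /multiple_of has_rcons => /orP[//|uG']; case/negP: uG.
pose t : R := \sum_(u <- msupp h) h@_u *: 'X_[u - g].
have hE : h = 'X_[g] * t.
  rewrite [LHS]mpolyE mulr_sumr; apply: eq_big_seq => u uh.
  by rewrite -scalerAr -mpolyXD addmC submK // hgu.
exists (mfilter (multiple_of G) f), t; split.
- by move=> u; rewrite msupp_mfilter => /andP[].
- by rewrite -hE /h -mfilter_split.
move=> z hf; split; first exact: homogz_mfilter.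
rewrite /t big_seq; apply: homogz_sum => u uh.
rewrite -mul_mpolyC; apply: homogzMC.
have -> : z - (mdeg g)%:Z = (mdeg (u - g)%MM)%:Z; last exact: homogzX.
have /homogzP/(_ u uh) <- : homogz z h by apply: homogz_mfilter.
by rewrite -{1}(submK (hgu u uh)) mdegD PoszD addrK.
Qed.

Lemma mon_ideal_rconsl G g f : mon_ideal G f -> mon_ideal (rcons G g) f.
Proof. by move=> fG u /fG uG; rewrite /multiple_of has_rcons (_ : has _ G) ?orbT. Qed.

Lemma mon_ideal_rconsX G g : mon_ideal (rcons G g) 'X_[g].
Proof. by move=> u /mem_msuppXP <-; rewrite /multiple_of has_rcons lepm_refl. Qed.

Definition vars (s : seq 'I_m) : seq 'X_{1..m} := [seq U_(i)%MM | i <- s].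

Lemma multiple_of_vars s u : multiple_of (vars s) u = has (fun i => u i != 0%N) s.
Proof. by rewrite /multiple_of has_map; apply: eq_has => i /=; rewrite lep1mP. Qed.

Lemma multiple_of_varsU s i u : i \notin s ->
  multiple_of (vars s) (U_(i) + u)%MM = multiple_of (vars s) u.
Proof.
move=> is_; rewrite !multiple_of_vars; apply: eq_in_has => j js.
rewrite mnmDE mnm1E; by case: (i =P j) is_ => // ->; rewrite js.
Qed.

Lemma vars_rcons s i : vars (rcons s i) = rcons (vars s) U_(i)%MM.
Proof. exact: map_rcons. Qed.

(** A variable is regular modulo the ideal generated by others, so the cone on it
    resolves the next quotient; this is the Koszul complex of the variables. *)
Lemma koszul_resolution (s : seq 'I_m) : uniq s ->
  exists F (e : 'cV[R]_(rank F 0)), resolves (mon_ideal (vars s)) e.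
Proof.
elim/last_ind: s => [_|s i IHs].
  exists (@FreeComplex k m (fun i => (i == 0)%N : nat) (fun _ _ => 0) (fun _ => 0)), 1.
  split.
  - by move=> i a b; rewrite mxE; apply: homogz0.
  - by move=> a; rewrite mxE ord1 -mpolyC1; apply: homogzC.
  - by exists 1; rewrite mulmx1 mxE subrr; apply/mon_ideal_nil.
  - move=> v; rewrite mulmx1 mon_ideal_nil; split=> [v0|[w ->]].
      by exists 0; rewrite mulmx0; apply/rowP => a; rewrite ord1 v0 mxE.
    by rewrite mulmx0 mxE.
  - move=> j v; split=> _; last by rewrite mulmx0.
    by exists 0; apply/rowP => -[].
rewrite rcons_uniq => /andP[is_ /IHs[F [e res]]].
exists (mapping_cone F 'X_i 1), (col_mx e (0 : 'M_(0, 1))).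
apply: (resolves_cone (mon_ideal_is_ideal _) res).
- by have := homogzX k U_(i)%MM; rewrite mdeg1.
- move=> f /mon_idealXM fs u /fs; by rewrite multiple_of_varsU.
- move=> f; rewrite vars_rcons; split=> [/mon_ideal_rcons_split[u [t [us fE _]]]|].
    by exists u, t.
  case=> [u [t [us ->]]]; apply: (idealD (mon_ideal_is_ideal _)).
    exact: mon_ideal_rconsl.
  by rewrite mulrC; apply: (idealM (mon_ideal_is_ideal _)); apply: mon_ideal_rconsX.
Qed.

Lemma irrelevant_vars (f : R) :
  f \in @irrelevant_ideal k m <-> mon_ideal (vars (enum 'I_m)) f.
Proof.
rewrite irrelevantE; split=> [f0 u uf|fm].
  rewrite multiple_of_vars; apply: contraT; rewrite -all_predC => /allP u0.
  have uE : u = 0%MM.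
    by apply/mnmP => i; rewrite mnm0E; have := u0 i;
      rewrite mem_enum /= negbK => /(_ isT)/eqP.
  by move: uf; rewrite uE mcoeff_msupp f0 eqxx.
apply/memN_msupp_eq0/negP => /fm; rewrite multiple_of_vars => /hasP[i _].
by rewrite mnm0E.
Qed.

Lemma resolution_exists : exists F
  (eps : 'I_(rank F 0) -> quotmod (@irrelevant_ideal k m)),
  graded_free_resolution (@quot_grading k m (@irrelevant_ideal k m)) eps.
Proof.
have [F [e res]] := koszul_resolution (enum_uniq 'I_m).
pose N := quotmod (@irrelevant_ideal k m).
exists F, (fun a => \pi_N (e a 0 : R^o)).
have T0 i : to_tensor (0 : 'rV_(rank F i)) = 0.
  by apply/ffunP => a; rewrite !ffunE mxE.
have augE (v : 'rV_(rank F 0)) :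
    augment (fun a => \pi_N (e a 0 : R^o)) (to_tensor v) = \pi_N ((v *m e) 0 0 : R^o).
  rewrite mxE raddf_sum /=; apply: eq_bigr => a _.
  by rewrite ffunE -piZ.
split.
- exact: (resolves_diff res).
- by move=> a; exists (e a 0) => //; apply: (resolves_eps res).
- elim/(@quotW _ N) => f; have [v vJ] := resolves_surj res.
  exists (to_tensor (f *: v)); rewrite augE; apply/esym/pi_eq.
  apply/irrelevant_vars; rewrite -scalemxAl mxE -[X in _ - X]mulr1 -mulrBr.
  exact: (idealM (mon_ideal_is_ideal _)).
- move=> x; have [v ->] := to_tensor_surj x; rewrite augE pi_eq0 irrelevant_vars.
  rewrite (resolves_exact0 res); split=> [[w ->]|[y]].
    by exists (to_tensor w); rewrite to_tensor_diff.
  have [w ->] := to_tensor_surj y; rewrite to_tensor_diff => /to_tensor_inj ->.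
  by exists w.
- move=> i x; have [v ->] := to_tensor_surj x; rewrite to_tensor_diff -(T0 i).
  split=> [/to_tensor_inj/(resolves_exactS res)[w ->]|[y]].
    by exists (to_tensor w); rewrite to_tensor_diff.
  have [w ->] := to_tensor_surj y; rewrite to_tensor_diff => /to_tensor_inj ->.
  by congr to_tensor; apply/(resolves_exactS res); exists w.
Qed.

End MonomialIdeals.

(** * Ideals with linear quotients *)

Section LinearQuotients.
Variables (k : fieldType) (m : nat).
Local Notation R := {mpoly k[m]}.
Implicit Types (G gs : seq 'X_{1..m}) (g u : 'X_{1..m}).

(** The ideal quotient of the generators before g by g is generated by the variables
    in S g; on exponents, it is a condition on the multiples of x^g. *)
Definition linear_quotients gs (S : 'X_{1..m} -> {set 'I_m}) : Prop :=
  forall G g G', gs = G ++ g :: G' ->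
  [/\ (0 < mdeg g)%N, {in G, forall h, (mdeg h <= mdeg g)%N} &
    forall u, multiple_of G (g + u)%MM = multiple_of (vars (enum (S g))) u].

(** For sorted generators the condition can be checked on pairs, with the earlier
    generators being the smaller ones: each variable x_t of S g is in the quotient,
    as x_t x^g is a multiple of a smaller generator, and a smaller generator h adds
    nothing else, as h : g is divisible by a variable of S g. *)
Lemma linear_quotients_sorted gs (S : 'X_{1..m} -> {set 'I_m}) : sorted <%O gs ->
  {in gs, forall g, (0 < mdeg g)%N} ->
  {in gs, forall g, forall i, i \in S g ->
    exists h, [/\ h \in gs, (h < g)%O & (h <= g + U_(i))%MM]} ->
  {in gs &, forall h g, (h < g)%O -> exists2 i, i \in S g & (g i < h i)%N} ->
  linear_quotients gs S.
Proof.
move=> gs_sort deg_gt0 colon_sub colon_sup G g G' gsE.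
have ggs : g \in gs by rewrite gsE mem_cat mem_head orbT.
have gs_pw : pairwise <%O gs by rewrite -sorted_pairwise //; exact: lt_trans.
move: gs_pw; rewrite gsE pairwise_cat allrel_consr /=.
move=> /and3P[/andP[Gg _] _ /andP[gG' _]].
have {}Gg h : h \in G -> (h < g)%O by move/(allP Gg).
have Ggs h : h \in G -> h \in gs by move=> hG; rewrite gsE mem_cat hG.
split=> [|h /Gg /ltW /lemc_mdeg //|u]; first exact: deg_gt0.
rewrite multiple_of_vars; apply/hasP/hasP => [[h hG /mnm_lepP hgu]|[i]].
  have [i iS gh] := colon_sup h g (Ggs h hG) ggs (Gg h hG).
  exists i; first by rewrite mem_enum.
  have := leq_trans gh (hgu i); rewrite mnmDE.
  by rewrite -{1}[g i]addn0 ltn_add2l lt0n.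
rewrite mem_enum => iS ui; have [h [hgs hg /mnm_lepP hgi]] := colon_sub g ggs i iS.
exists h.
  move: hgs; rewrite gsE mem_cat inE => /or3P[//|/eqP hE|/(allP gG') gh].
    by rewrite hE ltxx in hg.
  by have := lt_trans hg gh; rewrite ltxx.
apply/mnm_lepP => l; apply: leq_trans (hgi l) _.
rewrite !mnmDE leq_add2l mnm1E; case: eqP => // <-.
by rewrite lt0n.
Qed.

Variables (F : free_complex k m).
Variable eps : 'I_(rank F 0) -> quotmod (@irrelevant_ideal k m).
Hypothesis res :
  graded_free_resolution (@quot_grading k m (@irrelevant_ideal k m)) eps.
(* A graded change of coordinates and its inverse. *)
Variables phi psi : {rmorphism R -> R}.
Hypotheses (phiK : cancel phi psi) (psiK : cancel psi phi).
Hypothesis phi_homog : forall z f, homogz z f -> homogz z (phi f).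
Hypothesis psi_homog : forall z f, homogz z f -> homogz z (psi f).

(** The image under phi of the ideal generated by the monomials of exponents G. *)
Definition phi_mon_ideal G (f : R) : Prop := mon_ideal G (psi f).

Lemma phi_mon_ideal_is_ideal G : is_ideal (phi_mon_ideal G).
Proof.
have idG := mon_ideal_is_ideal k G; split=> [|f h|a f]; rewrite /phi_mon_ideal.
- by rewrite raddf0; apply: (ideal0 idG).
- by rewrite raddfD; apply: (idealD idG).
- by rewrite rmorphM; apply: (idealM idG).
Qed.

Section Step.
Variables (G : seq 'X_{1..m}) (g : 'X_{1..m}) (s : seq 'I_m).
Hypothesis colon : forall u, multiple_of G (g + u)%MM = multiple_of (vars s) u.
Local Notation J := (phi_mon_ideal G).
Local Notation K := (phi_mon_ideal (vars s)).
Local Notation d := (mdeg g)%:Z.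

Lemma phi_homogX : homogz d (phi 'X_[g]).
Proof. exact/phi_homog/homogzX. Qed.

Lemma phi_colon f : K f <-> J (phi 'X_[g] * f).
Proof.
rewrite /phi_mon_ideal rmorphM phiK mon_idealXM.
by split=> h u /h; rewrite colon.
Qed.

Lemma phi_rcons_split z (f : R) : homogz z f -> phi_mon_ideal (rcons G g) f ->
  exists v t, [/\ homogz z v, J v, homogz (z - d) t & f = v + phi 'X_[g] * t].
Proof.
move=> /psi_homog hf /mon_ideal_rcons_split[u [t [uG fE /(_ z hf)[hu ht]]]].
exists (phi u), (phi t); split; try exact: phi_homog.
  by rewrite /phi_mon_ideal phiK.
by rewrite -rmorphM -rmorphD -fE psiK.
Qed.

(** One step of the induction: in the long exact sequence of Tor for the new
    generator g, the maps from the homology modulo K to that modulo J vanish as soon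
    as their source or target does. *)
Lemma hdim_rcons q j b b' :
  hdim F K q (j - d) 0 \/ hdim F J q j 0 ->
  match q with
  | 0 => b' = 0%N
  | q'.+1 => hdim F K q' (j - d) b' /\ (hdim F K q' (j - d) 0 \/ hdim F J q' j 0)
  end ->
  hdim F J q j b -> hdim F (phi_mon_ideal (rcons G g)) q j (b + b').
Proof.
have idG := phi_mon_ideal_is_ideal.
have DH := diff_homog res; have DD := resolution_diff2 res.
have JJ f : J f -> phi_mon_ideal (rcons G g) f by apply: mon_ideal_rconsl.
have Jg : phi_mon_ideal (rcons G g) (phi 'X_[g]).
  by rewrite /phi_mon_ideal phiK; apply: mon_ideal_rconsX.
have mz i : hdim F K i (j - d) 0 \/ hdim F J i j 0 ->
    mul_zero F J K (phi 'X_[g]) d i j.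
  case; first exact: (mul_zero_source phi_homogX phi_colon).
  exact: (mul_zero_target phi_homogX phi_colon).
case: q => [|q] /mz z1 => [->|[hK /mz z0]] hJ.
  rewrite addn0.
  exact: (hdim_cone0 DH DD (idG _) JJ phi_colon phi_rcons_split z1).
exact: (hdim_coneS DH DD (idG _) (idG _) (idG _) JJ Jg phi_homogX phi_colon
  phi_rcons_split z1 z0).
Qed.

End Step.

Lemma hdim_nil q j : hdim F (phi_mon_ideal [::]) q j ((q == 0) && (j == 0)).
Proof.
have E f : f = 0 <-> phi_mon_ideal [::] f.
  rewrite /phi_mon_ideal mon_ideal_nil; split=> [->|f0]; first exact: raddf0.
  by rewrite -[f]psiK f0 raddf0.
apply: (hdim_iff E); case: q => [|q]; first exact: (hdim0_0 res).
exact: (hdim0_vanishS res).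
Qed.

(** The ideal of the earlier variables is equal to its quotient by the next one, so
    the Betti numbers obey the recursion of Pascal's triangle. *)
Lemma hdim_vars s q j : uniq s ->
  hdim F (phi_mon_ideal (vars s)) q j ((j == q%:Z) * 'C(size s, q)).
Proof.
elim/last_ind: s q j => [|s i IHs] q j.
  move=> _; have := hdim_nil q j; case: q => [|q] /=; first by rewrite bin0 muln1.
  by rewrite muln0.
rewrite rcons_uniq => /andP[is_ /IHs{}IHs].
have S1 q' : (j - (mdeg U_(i)%MM)%:Z == q'%:Z) = (j == q'.+1%:Z).
  by rewrite mdeg1 subr_eq -[q'.+1]addn1 PoszD.
(* The homology modulo the earlier variables lives in degree j = q' only. *)
have mz q' : hdim F (phi_mon_ideal (vars s)) q' (j - (mdeg U_(i)%MM)%:Z) 0 \/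
    hdim F (phi_mon_ideal (vars s)) q' j 0.
  have [jq|jq] := eqVneq j q'%:Z; last by right; have := IHs q' j; rewrite (negbTE jq).
  left; have := IHs q' (j - (mdeg U_(i)%MM)%:Z).
  by rewrite S1 jq eqz_nat ltn_eqF.
have colon u : multiple_of (vars s) (U_(i) + u)%MM = multiple_of (vars s) u.
  exact: multiple_of_varsU.
rewrite vars_rcons size_rcons.
case: q => [|q].
  have := hdim_rcons colon (mz 0%N) (erefl 0%N) (IHs 0%N j).
  by rewrite !bin0 addn0.
have := hdim_rcons colon (mz q.+1) (conj (IHs q _) (mz q)) (IHs q.+1 j).
by rewrite S1 -mulnDr -binS.
Qed.

(** The number beta_(q,j) of an ideal with linear quotients: a generator g of degree
    d contributes the Betti numbers of R/(x_t : t in S g), shifted by 1 in homological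
    degree and by d in internal degree. *)
Definition lq_betti gs (S : 'X_{1..m} -> {set 'I_m}) q j : nat :=
  if q is q'.+1 then
    \sum_(g <- gs) (j == (mdeg g + q')%N%:Z) * 'C(#|S g|, q')
  else j == 0.

(** Degrees are nondecreasing along gs, so below a generator of degree d the homology
    in place i sits in degrees less than d + i, while the homology modulo variables
    that could map to it has, after the shift by d, degree exactly d + i. *)
Lemma hdim_linear_quotients gs (S : 'X_{1..m} -> {set 'I_m}) q j :
  linear_quotients gs S -> hdim F (phi_mon_ideal gs) q j (lq_betti gs S q j).
Proof.
elim/last_ind: gs q j => [|G g IHG] q j lqG.
  by have := hdim_nil q j; case: q => [|q] //=; rewrite big_nil.
have [] := lqG G g [::] (esym (cats1 _ _)).
set d := mdeg g => d_gt0 degG colon.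
have {}IHG i j' : hdim F (phi_mon_ideal G) i j' (lq_betti G S i j').
  apply: IHG => G1 h G2 GE; apply: (lqG _ _ (rcons G2 g)).
  by rewrite GE -!cats1 -catA.
have hK i := hdim_vars i (j - d%:Z) (enum_uniq (S g)).
have S1 i : (j - d%:Z == i%:Z) = (j == (d + i)%N%:Z).
  by rewrite subr_eq addnC PoszD.
(* Both can be nonzero in no degree j. *)
have mz i : hdim F (phi_mon_ideal (vars (enum (S g)))) i (j - d%:Z) 0 \/
    hdim F (phi_mon_ideal G) i j 0.
  have [ji|ji] := boolP (j - d%:Z == i%:Z); last first.
    by left; have := hK i; rewrite (negbTE ji).
  right; have := IHG i j; rewrite S1 in ji; rewrite (eqP ji).
  case: i {ji} => [|i] /=; first by rewrite addn0 eqz_nat gtn_eqF.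
  rewrite big_seq big1 // => h hG; rewrite eqz_nat addnS -addSn eqn_add2r.
  by rewrite gtn_eqF // ltnS degG.
case: q => [|q].
  by have := hdim_rcons colon (mz 0%N) (erefl 0%N) (IHG 0%N j); rewrite addn0.
have := hdim_rcons colon (mz q.+1) (conj (hK q) (mz q)) (IHG q.+1 j).
by rewrite S1 /= -cats1 big_cat big_seq1 cardE.
Qed.

End LinearQuotients.

(** * Linear changes of coordinates *)

Section LinearSubstitution.
Variables (k : fieldType) (m : nat).
Local Notation R := {mpoly k[m]}.
Implicit Types (A B : 'M[k]_m) (f : R).

Definition lin_forms A : m.-tuple R := [tuple \sum_j A j l *: 'X_j | l < m].

Definition lin_subst A : {rmorphism R -> R} := comp_mpoly (lin_forms A).

Lemma lin_substX A l : lin_subst A 'X_l = \sum_j A j l *: 'X_j.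
Proof. by rewrite /= comp_mpolyXU -tnth_nth tnth_mktuple. Qed.

Lemma lin_substZ A (c : k) f : lin_subst A (c *: f) = c *: lin_subst A f.
Proof. exact: comp_mpolyZ. Qed.

Lemma lin_subst_sum A (I : Type) (s : seq I) (P : pred I) (G : I -> R) :
  lin_subst A (\sum_(i <- s | P i) G i) = \sum_(i <- s | P i) lin_subst A (G i).
Proof. exact: raddf_sum. Qed.

Lemma lin_subst_mon A (u : 'X_{1..m}) :
  lin_subst A 'X_[u] = \prod_l lin_subst A 'X_l ^+ u l.
Proof.
rewrite [LHS]comp_mpolyX; apply: eq_bigr => l _; congr (_ ^+ _).
by rewrite /= comp_mpolyXU -tnth_nth.
Qed.

Lemma lin_substK A B : A *m B = 1%:M -> cancel (lin_subst B) (lin_subst A).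
Proof.
move=> AB f; rewrite {1}(mpolyE f) (lin_subst_sum B) (lin_subst_sum A) [RHS]mpolyE.
apply: eq_bigr => u _.
rewrite (lin_substZ B) (lin_substZ A) (lin_subst_mon B) rmorph_prod; congr (_ *: _).
rewrite [RHS]mpolyXE_id; apply: eq_bigr => l _; rewrite rmorphXn; congr (_ ^+ _).
rewrite (lin_substX B) lin_subst_sum.
transitivity (\sum_i (A *m B) i l *: ('X_i : R)).
  under eq_bigr => j _ do rewrite (lin_substZ A) (lin_substX A) scaler_sumr.
  rewrite exchange_big /=; apply: eq_bigr => i _; rewrite mxE scaler_suml.
  by apply: eq_bigr => j _; rewrite scalerA mulrC.
rewrite AB (bigD1 l) //= mxE eqxx scale1r big1 ?addr0 // => i il.
by rewrite mxE (negbTE il) scale0r.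
Qed.

Lemma lin_subst_homog A z f : homogz z f -> homogz z (lin_subst A f).
Proof.
move=> /homogzP hf; rewrite (mpolyE f) big_seq lin_subst_sum; apply: homogz_sum => u uf.
rewrite (lin_substZ A) -mul_mpolyC; apply: homogzMC.
rewrite -(hf u uf) mdegE lin_subst_mon.
apply: (big_ind2 (fun (g : R) d => homogz d%:Z g)) => [|g d g' d' hg hg'|l _].
- exact: homogzC.
- by rewrite PoszD; apply: homogzM.
elim: (u l) => [|e IHe]; first exact: homogzC.
rewrite exprS -add1n PoszD; apply: homogzM => //.
rewrite (lin_substX A); apply: homogz_sum => j _.
rewrite -mul_mpolyC; apply: homogzMC.
by have := homogzX k U_(j)%MM; rewrite mdeg1.
Qed.

Lemma meval_lin_subst A f v :
  (lin_subst A f).@[v] = f.@[fun l => \sum_j v j * A j l].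
Proof.
rewrite /= comp_mpoly_meval; apply: meval_eq => l.
rewrite tnth_mktuple raddf_sum; apply: eq_bigr => j _.
by rewrite /= mevalZ mevalXU mulrC.
Qed.

End LinearSubstitution.

(** * The ideal of a double point in suitable coordinates *)

Section DoublePoint.
Variables (k : fieldType) (m : nat).
Local Notation R := {mpoly k[m]}.
Variables (A : 'M[k]_m) (A_unit : A \in unitmx) (i : 'I_m).
Local Notation phi := (lin_subst (invmx A)).
Local Notation psi := (lin_subst A).

Let psiK : cancel psi phi.
Proof. by apply: lin_substK; rewrite mulVmx. Qed.

(** The monomials of f have degree at least c in the variables other than x_i: for
    c = 1 this is the ideal of the i-th coordinate point, for c = 2 its square. *)
Definition off_degree c (f : R) : Prop :=
  forall u, u \in msupp f -> (u i + c <= mdeg u)%N.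

Lemma off_degree_ideal c : is_ideal (off_degree c).
Proof.
split=> [u|f g hf hg u|a f hf u].
- by rewrite msupp0.
- by move=> /msuppD_le; rewrite mem_cat => /orP[/hf|/hg].
move=> /msuppM_le /allpairsP[[u1 u2] /= [_ /hf h ->]].
rewrite mnmDE mdegD -addnA leq_add //.
by rewrite mdegE (bigD1 i) //= leq_addr.
Qed.

Lemma off_degreeM c c' f g : off_degree c f -> off_degree c' g ->
  off_degree (c + c') (f * g).
Proof.
move=> hf hg u /msuppM_le /allpairsP[[u1 u2] /= [/hf h1 /hg h2 ->]].
by rewrite mnmDE mdegD addnACA leq_add.
Qed.

Lemma off_degree_span (G : R -> Prop) c : (forall f, G f -> off_degree c (psi f)) ->
  forall f, f \in ideal_span G -> off_degree c (psi f).
Proof.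
move=> hG f /asboolP[s [sG ->]]; rewrite lin_subst_sum big_seq.
have idc := off_degree_ideal c.
apply: big_ind => [||p /sG Gp]; [exact: (ideal0 idc)|exact: (idealD idc)|].
by rewrite rmorphM; apply/(idealM idc)/hG.
Qed.

(** The value of a form of degree d at the i-th coordinate point is its coefficient
    of x_i^d. *)
Lemma point_ideal_off_degree f : f \in point_ideal (A i) -> off_degree 1 (psi f).
Proof.
apply: off_degree_span => {}f [[d fd] fA] u uf.
have /homogzP hf : homogz d%:Z (psi f) by apply: lin_subst_homog.
have off (v : 'X_{1..m}) t : v i = mdeg v -> t != i -> v t = 0%N.
  move=> vi ti; apply/eqP; move: vi => /eqP.
  rewrite mdegE (bigD1 i) //= -{1}[v i]addn0 eqn_add2l eq_sym sum_nat_eq0.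
  by move=> /forallP/(_ t); rewrite ti.
have ui : (u i <= mdeg u)%N by rewrite mdegE (bigD1 i) //= leq_addr.
rewrite addn1 ltn_neqAle ui andbT; apply/eqP => uiE.
have : (psi f).@[fun j => (i == j)%:R] = 0.
  rewrite meval_lin_subst -[RHS]fA; apply: meval_eq => l.
  rewrite (bigD1 i) //= eqxx mul1r big1 ?addr0 // => j ji.
  by rewrite eq_sym (negbTE ji) mul0r.
rewrite mevalE (bigD1_seq u) ?msupp_uniq //= [X in _ * X]big1 => [|t _]; last first.
  have [it|it] := eqVneq i t; first by rewrite expr1n.
  by rewrite (off u t) ?expr0 // eq_sym.
rewrite big_seq_cond big1 ?addr0 ?mulr1 => [/eqP|v /andP[vf vu]].
  by apply/negP; rewrite -mcoeff_msupp.
have [t ti vt] : exists2 t, t != i & v t != 0%N.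
  apply/exists_inP; apply: contraNT vu; rewrite negb_exists_in => /forall_inP v0.
  apply/eqP/mnmP => t; have [->|ti] := eqVneq t i; last first.
    by rewrite (off u) //; have := v0 t ti; rewrite negbK => /eqP.
  rewrite uiE; have /esym := hf v vf; rewrite -(hf u uf) => -[->].
  rewrite mdegE (bigD1 i) //= big1 ?addn0 // => l li.
  by have := v0 l li; rewrite negbK => /eqP.
by rewrite (bigD1 t) //= eq_sym (negbTE ti) expr0n (negbTE vt) mul0r mulr0.
Qed.

Lemma off_variable_point j : j != i -> phi 'X_j \in point_ideal (A i).
Proof.
move=> ji; apply/asboolP; exists [:: (1, phi 'X_j)].
rewrite big_seq1 mul1r; split=> // p; rewrite inE => /eqP -> /=; split.
  exists 1%N; have := homogzX k U_(j)%MM; rewrite mdeg1.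
  exact: (lin_subst_homog (invmx A)).
rewrite meval_lin_subst mevalXU.
have -> : \sum_l A i l * invmx A l j = (A *m invmx A) i j by rewrite mxE.
by rewrite mulmxV // mxE eq_sym (negbTE ji).
Qed.

Lemma off_degree_variable c (u : 'X_{1..m}) : (u i + c.+1 <= mdeg u)%N ->
  exists2 j, j != i & exists2 v : 'X_{1..m}, (v i + c <= mdeg v)%N & u = (U_(j) + v)%MM.
Proof.
move=> ui; have [j ji uj] : exists2 j, j != i & u j != 0%N.
  apply/exists_inP; apply: contraLR ui; rewrite negb_exists_in => /forall_inP u0.
  rewrite -ltnNge mdegE (bigD1 i) //= big1 => [|j /u0]; last by rewrite negbK => /eqP.
  by rewrite ltn_add2l.
exists j => //; exists (u - U_(j))%MM; last by rewrite addmC submK // lep1mP.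
have uE : (u - U_(j) + U_(j))%MM = u by rewrite submK // lep1mP.
have := ui; rewrite -[in mdeg u]uE mdegD mdeg1 mnmBE mnm1E (negbTE ji) subn0.
by rewrite addnS addn1 ltnS.
Qed.

(** A monomial of degree at least 2 off x_i is a multiple of x_j x_j' with j and j'
    different from i, and these variables are linear forms that vanish at the point. *)
Lemma double_point_idealE f :
  f \in double_point_ideal (A i) <-> off_degree 2 (psi f).
Proof.
split=> [|fA].
  apply: off_degree_span => h [f1 [f2 [/point_ideal_off_degree h1]]].
  by move=> /point_ideal_off_degree h2 ->; rewrite rmorphM; apply: (off_degreeM h1 h2).
rewrite -[f]psiK (mpolyE (psi f)) big_seq lin_subst_sum.
apply: (@rpred_sum _ (double_point_ideal (A i))) => u /fA.
case/off_degree_variable => j ji [v /off_degree_variable[j' j'i [w _ ->]] ->].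
set c := _@__; apply/asboolP.
exists [:: (c *: phi 'X_[w], phi 'X_j * phi 'X_j')].
split=> [p|]; last first.
  transitivity (c *: phi 'X_[w] * (phi 'X_j * phi 'X_j')); last by rewrite big_seq1.
  by rewrite lin_substZ !mpolyXD !rmorphM -scalerAl [in RHS]mulrC mulrA.
rewrite inE => /eqP ->.
by exists (phi 'X_j), (phi 'X_j'); split=> //; apply: off_variable_point.
Qed.
End DoublePoint.

Local Open Scope nat_scope.

(** * Exponents as sequences of variables *)

Section Exponents.
Variable m : nat.
Implicit Types (s t : seq 'I_m) (u g h : 'X_{1..m}).

Lemma s2mE s i : s2m s i = count_mem i s.
Proof. exact: mnmE. Qed.

Lemma s2m_perm s t : perm_eq s t -> s2m s = s2m t.
Proof. by move=> /permP st; apply/mnmP => i; rewrite !s2mE st. Qed.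

Lemma s2m_cons i s : s2m (i :: s) = (U_(i) + s2m s)%MM.
Proof. by apply/mnmP => j; rewrite mnmDE mnm1E !s2mE. Qed.

Lemma mdeg_s2m s : mdeg (s2m s) = size s.
Proof.
elim: s => [|i s IHs]; last by rewrite s2m_cons mdegD mdeg1 IHs.
by apply/eqP; rewrite mdeg_eq0; apply/eqP/mnmP => i; rewrite !mnmE.
Qed.

Lemma s2m_inj s t : sorted (relpre val leq) s -> sorted (relpre val leq) t ->
  s2m s = s2m t -> s = t.
Proof.
move=> ss st /mnmP E; apply: (@sorted_eq _ (relpre val leq)) => //.
- by move=> y x z; apply: leq_trans.
- by move=> x y /anti_leq/val_inj.
- by apply/allP => i _ /=; apply/eqP; have := E i; rewrite !s2mE.
Qed.

Lemma s2m_le s u : {in s, forall i, count_mem i s <= u i} -> (s2m s <= u)%MM.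
Proof.
move=> su; apply/mnm_lepP => i; rewrite s2mE.
by have [/su//|/count_memPn->] := boolP (i \in s).
Qed.

Lemma s2m_lt (i j : 'I_m) s : i < j -> (s2m (j :: s) < s2m (i :: s))%O.
Proof.
move=> ij; apply/ltmcP; first by rewrite !mdeg_s2m.
exists i => [l li|]; rewrite !s2mE /=; last first.
  by rewrite eqxx ltn_add2r -(inj_eq val_inj) /= gtn_eqF.
congr (nat_of_bool _ + _).
by rewrite -!(inj_eq val_inj) /= !gtn_eqF // (ltn_trans li).
Qed.

(** The first entry where h and g differ is smaller in h; as the degrees are equal,
    h has to make up for it at a later variable. *)
Lemma lex_excess g h : mdeg h = mdeg g -> (h < g)%O ->
  exists p t : 'I_m, [/\ p < t, 0 < g p & g t < h t].
Proof.
move=> hg; case/(ltmcP hg) => p hp gp.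
have [/existsP[t /andP[pt gt]]|] := boolP [exists t : 'I_m, (p < t) && (g t < h t)].
  by exists p, t; split=> //; apply: leq_ltn_trans gp.
rewrite negb_exists => /forallP le; suff : mdeg h < mdeg g by rewrite hg ltnn.
rewrite !mdegE (bigD1 p) // [X in _ < X](bigD1 p) //= -addSn leq_add //.
apply: leq_sum => t tp; have := le t.
case: (ltngtP t p) => [/hp ->//||/val_inj tp'] /=; first by rewrite -leqNgt.
by rewrite tp' eqxx in tp.
Qed.

(** Used to pick the variables of a monomial one by one: either one more variable
    divides it, or its degree is concentrated on those already found. *)
Lemma mdeg_support s u : uniq s -> 
  (exists2 t, t \notin s & u t != 0) \/ mdeg u = \sum_(t <- s) u t.
Proof.
move=> us; have [/existsP[t /andP[ts ut]]|] :=
  boolP [exists t, (t \notin s) && (u t != 0)].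
  by left; exists t.
rewrite negb_exists => /forallP u0; right.
rewrite mdegE (bigID (mem s)) /= [X in _ + X]big1 ?addn0 => [|t ts]; last first.
  by have := u0 t; rewrite ts negbK => /eqP.
by rewrite -big_uniq.
Qed.

End Exponents.

(** * The monomial generators *)

Section Generators.
Variables (n r : nat).
Local Notation V := 'I_n.+1.
Implicit Types (u g h : 'X_{1..n.+1}) (a b i j l t : V) (s : seq V).

(** Monomials are written as weakly increasing words in the variables, which makes
    the enumeration of the generators free of repetitions. *)
Definition quadric_words : seq (seq V) :=
  [seq [:: p.1; p.2] | p <- enum [pred p : V * V | r < p.1 <= p.2]].

Definition cubic_words : seq (seq V) :=
  [seq [:: p.1.1; p.1.2; p.2] |
     p <- enum [pred p : V * V * V | (p.1.1 < p.1.2 <= r) && (p.1.2 < p.2)]].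

Definition quartic_words : seq (seq V) :=
  [seq [:: p.1; p.1; p.2; p.2] | p <- enum [pred p : V * V | p.1 < p.2 <= r]].

Definition generators : seq 'X_{1..n.+1} :=
  [seq s2m s | s <- quadric_words ++ cubic_words ++ quartic_words].

Variant generator_spec g : Prop :=
| QuadricSpec a b of r < a & a <= b & g = s2m [:: a; b]
| CubicSpec i j l of i < j & j <= r & j < l & g = s2m [:: i; j; l]
| QuarticSpec i j of i < j & j <= r & g = s2m [:: i; i; j; j].

Lemma generatorP g : g \in generators -> generator_spec g.
Proof.
case/mapP => s; rewrite !mem_cat => /or3P[] /mapP[p]; rewrite mem_enum inE.
- by move=> /andP[ra ab] -> ->; exact: QuadricSpec ra ab erefl.
- by move=> /andP[/andP[ij jr] jl] -> ->; exact: CubicSpec ij jr jl erefl.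
- by move=> /andP[ij jr] -> ->; exact: QuarticSpec ij jr erefl.
Qed.

Lemma generators_uniq : uniq generators.
Proof.
rewrite map_inj_in_uniq.
  rewrite !cat_uniq !map_inj_uniq ?enum_uniq /=.
  2-4: by [case=> a b [c d] [*]; subst | case=> [[a b] e] [[c d] f] [*]; subst].
  rewrite andbT has_cat negb_or -!all_predC -andbA; apply/and3P.
  by split; apply/allP => s /mapP[p _ ->]; apply/negP => /mapP[].
suff srt s : s \in quadric_words ++ cubic_words ++ quartic_words ->
    sorted (relpre val leq) s.
  by move=> s t /srt ss /srt st; apply: s2m_inj.
rewrite !mem_cat => /or3P[] /mapP[p]; rewrite mem_enum inE.
- by move=> /andP[_ ab] -> /=; rewrite ab.
- by move=> /andP[/andP[ij _] jl] -> /=; rewrite (ltnW ij) (ltnW jl).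
- by move=> /andP[ij _] -> /=; rewrite !leqnn (ltnW ij).
Qed.

Lemma quadric_generator a b : r < a -> r < b -> s2m [:: a; b] \in generators.
Proof.
wlog ab : a b / a <= b => [IH ra rb|ra rb].
  have [ab|/ltnW ba] := leqP a b; first exact: IH.
  by rewrite (s2m_perm (_ : perm_eq _ [:: b; a])) ?IH // (perm_catC [:: a] [:: b]).
apply: map_f; rewrite mem_cat; apply/orP; left.
by apply/mapP; exists (a, b); rewrite // mem_enum inE /= ra ab.
Qed.

Lemma cubic_generator i j l : uniq [:: i; j; l] -> i <= r -> j <= r ->
  s2m [:: i; j; l] \in generators.
Proof.
have srt (x y z : V) : x < y -> y < z -> y <= r -> s2m [:: x; y; z] \in generators.
  move=> xy yz yr; apply: map_f; rewrite !mem_cat; apply/or3P/Or32.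
  by apply/mapP; exists (x, y, z); rewrite // mem_enum inE /= xy yz yr.
wlog ij : i j / i < j => [IH u ir jr|u ir jr].
  have [ij|ji|/val_inj ij] := ltngtP i j; [exact: IH| |by move: u; rewrite ij /= inE eqxx].
  have p : perm_eq [:: i; j; l] [:: j; i; l] by rewrite (perm_catCA [:: i] [:: j]).
  by rewrite (s2m_perm p) IH // -(perm_uniq p).
have [jl|lj|/val_inj jl] := ltngtP j l; last by move: u; rewrite jl /= !inE eqxx /= andbF.
  exact: srt.
have [il|li|/val_inj il] := ltngtP i l; last by move: u; rewrite il /= !inE eqxx orbT.
  rewrite (s2m_perm (_ : perm_eq _ [:: i; l; j])) ?srt ?(leq_trans (ltnW lj)) //.
  by rewrite perm_cons (perm_catC [:: j] [:: l]).
rewrite (s2m_perm (_ : perm_eq _ [:: l; i; j])) ?srt //.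
by rewrite (perm_catC [:: i; j] [:: l]).
Qed.

Lemma quartic_generator i j : i != j -> i <= r -> j <= r ->
  s2m [:: i; i; j; j] \in generators.
Proof.
wlog ij : i j / i < j => [IH u ir jr|u ir jr].
  have [ij|ji|/val_inj ij] := ltngtP i j; [exact: IH| |by move: u; rewrite ij eqxx].
  rewrite (s2m_perm (_ : perm_eq _ [:: j; j; i; i])) ?IH //; first by rewrite eq_sym.
  by rewrite (perm_catC [:: i; i] [:: j; j]).
apply: map_f; rewrite !mem_cat; apply/or3P/Or33.
by apply/mapP; exists (i, j); rewrite // mem_enum inE /= ij jr.
Qed.

Lemma generators_off g i : g \in generators -> i <= r -> g i + 2 <= mdeg g.
Proof.
move=> /generatorP gP ir; case: gP => [a b ra ab|i' j l ij jr jl|i' j ij jr] ->;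
  rewrite mdeg_s2m s2mE /= -!(inj_eq val_inj) /=; lia.
Qed.

(** If a variable x_a with a > r divides x^u, then either a quadric does, or the rest
    of x^u involves two variables up to r, whose product with x_a is a cubic.  If none
    does, then either three variables divide x^u, and so does a cubic, or only two
    do; in that case the condition forces both to occur twice. *)
Lemma multiple_of_generators u :
  multiple_of generators u <-> forall i : V, i <= r -> u i + 2 <= mdeg u.
Proof.
split=> [/hasP[g gG /= gu] i ir|uI].
  rewrite -(submK gu) mdegD mnmDE -addnA leq_add ?generators_off //.
  by rewrite mdegE (bigD1 i) //= leq_addr.
have mult s : s2m s \in generators ->
    {in s, forall i, count_mem i s <= u i} -> multiple_of generators u.
  by move=> sG /s2m_le su; apply/hasP; exists (s2m s).
have pos2 (i j : V) : i != j -> u i != 0 -> u j != 0 ->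
    {in [:: i; j], forall t, count_mem t [:: i; j] <= u t}.
  move=> ij ui uj t; rewrite !inE => /orP[] /eqP -> /=.
    by rewrite eqxx eq_sym (negbTE ij) addn0 lt0n.
  by rewrite eqxx (negbTE ij) lt0n.
have pos3 (i j l : V) : uniq [:: i; j; l] -> u i != 0 -> u j != 0 -> u l != 0 ->
    {in [:: i; j; l], forall t, count_mem t [:: i; j; l] <= u t}.
  move=> ijl ui uj ul t tijl; rewrite count_uniq_mem // tijl lt0n.
  by move: tijl; rewrite !inE => /or3P[] /eqP ->.
have sq (i : V) : 1 < u i -> {in [:: i; i], forall t, count_mem t [:: i; i] <= u t}.
  by move=> ui t; rewrite !inE orbb => /eqP -> /=; rewrite eqxx.
have [/existsP[a /andP[ra ua]]|] := boolP [exists a : V, (r < a) && (u a != 0)].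
  have quad (t : V) : t != a -> r < t -> u t != 0 -> multiple_of generators u.
    move=> ta rt ut; apply: (mult [:: t; a]); first exact: quadric_generator.
    exact: pos2.
  have quad2 : 1 < u a -> multiple_of generators u.
    by move=> /sq; apply: mult; apply: quadric_generator.
  have [[i ia ui]|uE] := mdeg_support u (isT : uniq [:: a]); last first.
    by apply: quad2; move: (uI ord0 (leq0n r)); rewrite uE big_seq1; lia.
  rewrite inE in ia; have [ri|ir] := ltnP r i; first exact: quad ia ri ui.
  have ai : uniq [:: a; i] by rewrite /= inE eq_sym ia.
  have [[j ja uj]|uE] := mdeg_support u ai; last first.
    by apply: quad2; move: (uI i ir); rewrite uE big_cons big_seq1; lia.
  move: ja; rewrite !inE negb_or => /andP[ja ji].
  have [rj|jr] := ltnP r j; first exact: quad ja rj uj.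
  have ija : uniq [:: i; j; a] by rewrite /= !inE negb_or ia ja eq_sym ji.
  by apply: (mult [:: i; j; a]); [apply: cubic_generator | apply: pos3].
rewrite negb_exists => /forallP uhigh.
have low i : u i != 0 -> i <= r.
  by move=> ui; have := uhigh i; rewrite ui andbT -leqNgt.
have [[i _ ui]|uE] := mdeg_support u (isT : uniq [::]); last first.
  by move: (uI ord0 (leq0n r)); rewrite uE big_nil; lia.
have [[j ji uj]|uE] := mdeg_support u (isT : uniq [:: i]); last first.
  by move: (uI i (low i ui)); rewrite uE big_seq1; lia.
rewrite inE eq_sym in ji.
have ij : uniq [:: i; j] by rewrite /= inE ji.
have [[l lij ul]|uE] := mdeg_support u ij.
  have ijl : uniq [:: i; j; l].
    by move: lij; rewrite /= !inE !negb_or ji andbT ![l == _]eq_sym.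
  by apply: (mult [:: i; j; l]); [apply: cubic_generator; rewrite ?low | apply: pos3].
have ui2 := uI i (low i ui); have uj2 := uI j (low j uj).
rewrite uE big_cons big_seq1 in ui2 uj2.
apply: (mult [:: i; i; j; j]); first by apply: quartic_generator; rewrite ?low.
move=> t; rewrite !inE !orbA orbb -orbA orbb => /orP[] /eqP -> /=.
  by rewrite eqxx eq_sym (negbTE ji); lia.
by rewrite eqxx (negbTE ji); lia.
Qed.

End Generators.

(** * The linear quotients of the generators *)
Section ColonSets.
Variables (n r : nat).
Local Notation V := 'I_n.+1.
Implicit Types (u g h : 'X_{1..n.+1}) (a b i j l t : V) (s : seq V).

(** The set S(g), in a form common to all generators: for quartics there is no
    condition on the position of t, the remaining factor of g staying a cubic. *)
Definition colon_set g : {set V} :=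
  [set t : V | ((mdeg g < 4) ==> [exists i : V, (i < t) && (g i != 0)])
            && ((t <= r) ==> (g t == 0))].

Lemma s2m_neq0 s i : (s2m s i != 0) = (i \in s).
Proof. by rewrite s2mE -lt0n -has_count has_pred1. Qed.

Lemma colon_set_quadric a b t : r < a -> a <= b ->
  (t \in colon_set (s2m [:: a; b])) = (a < t).
Proof.
move=> ra ab; rewrite inE mdeg_s2m /=.
have -> : [exists i : V, (i < t) && (s2m [:: a; b] i != 0)] = (a < t).
  apply/existsP/idP => [[i /andP[it]]|at_]; last first.
    by exists a; rewrite at_ s2m_neq0 mem_head.
  rewrite s2m_neq0 !inE => /orP[] /eqP iE; first by rewrite -iE.
  by apply: leq_ltn_trans ab _; rewrite -iE.
case: ltnP => //= at_; rewrite [t <= r]leqNgt.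
by rewrite (ltn_trans ra at_).
Qed.

Lemma colon_set_cubic i j l t : i < j -> j <= r -> j < l ->
  (t \in colon_set (s2m [:: i; j; l])) = [&& i < t, t != j & (t <= r) ==> (t != l)].
Proof.
move=> ij jr jl; rewrite inE mdeg_s2m /=.
have -> : [exists x : V, (x < t) && (s2m [:: i; j; l] x != 0)] = (i < t).
  apply/existsP/idP => [[x /andP[xt]]|it]; last first.
    by exists i; rewrite it s2m_neq0 mem_head.
  rewrite s2m_neq0 !inE => /or3P[] /eqP xE; move: xt; rewrite xE //.
    exact: ltn_trans.
  by apply: ltn_trans; apply: ltn_trans jl.
case: ltnP => //= it; rewrite -[_ == 0]negbK s2m_neq0 !inE.
rewrite -!(inj_eq val_inj) /=; lia.
Qed.

Lemma colon_set_quartic i j t : i < j -> j <= r ->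
  (t \in colon_set (s2m [:: i; i; j; j])) = (t != i) && (t != j).
Proof.
move=> ij jr; rewrite inE mdeg_s2m /=.
rewrite -[_ == 0]negbK s2m_neq0 !inE -!(inj_eq val_inj) /=; lia.
Qed.

(** For t in S(g), trade the first variable of a quadric or cubic for x_t to get a
    lexicographically smaller generator, unless x_t x_l is a quadric for a variable x_l
    of g; for x_i^2 x_j^2 the smaller generator is the cubic x_i x_j x_t. *)
Lemma colon_set_sub g t : g \in generators n r -> t \in colon_set g ->
  exists h, [/\ h \in generators n r, (h < g)%O & (h <= g + U_(t))%MM].
Proof.
have deg_lt s s' : size s < size s' -> (s2m s < s2m s' :> 'X_{1..n.+1})%O.
  by move=> ss; apply: lt_mdeg_ltmc; rewrite !mdeg_s2m.
have le_cons s s' : subseq s' (t :: s) -> (s2m s' <= s2m s + U_(t))%MM.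
  move=> ss; rewrite addmC -s2m_cons; apply/mnm_lepP => x.
  by rewrite !s2mE; exact: leq_count_subseq.
move=> /generatorP[a b ra ab ->|i j l ij jr jl ->|i j ij jr ->].
- rewrite colon_set_quadric // => at_; exists (s2m [:: t; b]); split.
  + by apply: quadric_generator; [apply: ltn_trans at_ | apply: leq_trans ab].
  + exact: s2m_lt.
  + by apply/le_cons/subseqP; exists [:: true; false; true].
- rewrite colon_set_cubic // => /and3P[it tj tl].
  have [/andP[rt rl]|] := boolP ((r < t) && (r < l)).
    exists (s2m [:: t; l]); split.
    + exact: quadric_generator.
    + exact: deg_lt.
    + by apply/le_cons/subseqP; exists [:: true; false; false; true].
  rewrite negb_and -!leqNgt => low; exists (s2m [:: t; j; l]); split.
  + have ltj : uniq [:: t; j; l].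
      rewrite /= !inE negb_or tj -!(inj_eq val_inj) /= (ltn_eqF jl).
      by move: tl low; rewrite -!(inj_eq val_inj) /=; lia.
    have [tr|rt] := leqP t r; first exact: cubic_generator.
    have lr : l <= r by move: low; rewrite leqNgt rt.
    have p : perm_eq [:: t; j; l] [:: j; l; t] by rewrite (perm_catC [:: t] [:: j; l]).
    by rewrite (s2m_perm p); apply: cubic_generator; rewrite // -(perm_uniq p).
  + exact: s2m_lt.
  + by apply/le_cons/subseqP; exists [:: true; false; true; true].
- rewrite colon_set_quartic // => /andP[ti tj]; exists (s2m [:: i; j; t]); split.
  + apply: cubic_generator => //; last exact: ltnW (leq_trans ij _).
    by rewrite /= !inE negb_or -!(inj_eq val_inj) /= (ltn_eqF ij) !andbT eq_sym ti eq_sym tj.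
  + exact: deg_lt.
  + rewrite (s2m_perm (_ : perm_eq _ [:: t; i; j])).
      by apply/le_cons/subseqP; exists [:: true; true; false; true; false].
    by rewrite (perm_catC [:: i; j] [:: t]).
Qed.

(** A quartic g involves only x_i and x_j, and every other generator involves a third
    variable.  Otherwise, if h has the degree of g, it exceeds g at a variable after
    the first one of g; if g is a cubic and h a quadric, both variables of h come after
    x_r, and at most one of them occurs in g, only once. *)
Lemma colon_set_sup h g : h \in generators n r -> g \in generators n r ->
  (h < g)%O -> exists2 t, t \in colon_set g & g t < h t.
Proof.
move=> hG gG hg; have /ltW/lemc_mdeg deg_hg := hg.
have [g4|g4] := ltnP (mdeg g) 4; last first.
  case/generatorP: gG g4 hg {deg_hg} => [a b ra ab|i j l ij jr jl|i j ij jr] ->;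
    rewrite mdeg_s2m // => _ hg.
  suff [t [ti tj ht]] : exists t, [/\ t != i, t != j & h t != 0].
    exists t; first by rewrite colon_set_quartic // ti tj.
    rewrite s2mE /= ![_ == t]eq_sym (negbTE ti) (negbTE tj) lt0n //.
  case/generatorP: hG hg => [a b ra ab|i' j' l' ij' jr' jl'|i' j' ij' jr'] -> hg.
  - exists a; rewrite s2m_neq0 mem_head -!(inj_eq val_inj) /=; split=> //; lia.
  - have [t [t3 ti tj]] : exists t, [/\ t \in [:: i'; j'; l'], t != i & t != j].
      have [i'i|] := boolP ((i' != i) && (i' != j)).
        by case/andP: i'i; exists i'; rewrite mem_head.
      have [j'i|] := boolP ((j' != i) && (j' != j)).
        by case/andP: j'i; exists j'; rewrite !inE eqxx orbT.
      rewrite -!(inj_eq val_inj) /= => h1 h2; exists l'.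
      by rewrite !inE eqxx !orbT -!(inj_eq val_inj) /=; split=> //; lia.
    by exists t; rewrite s2m_neq0.
  - have [i'i|h1] := boolP ((i' != i) && (i' != j)).
      by case/andP: i'i; exists i'; rewrite s2m_neq0 mem_head.
    have [j'i|h2] := boolP ((j' != i) && (j' != j)).
      by case/andP: j'i; exists j'; rewrite s2m_neq0 !inE eqxx !orbT.
    suff [ii' jj'] : i' = i /\ j' = j by rewrite ii' jj' ltxx in hg.
    move: h1 h2; rewrite -!(inj_eq val_inj) /= => h1 h2.
    by split; apply/val_inj => /=; lia.
have hlow t : t <= r -> h t <= 1.
  move=> tr.
  case/generatorP: hG deg_hg {hg} => [a b ra ab|i' j' l' ij' jr' jl'|i' j' ij' jr'] ->.
  - by rewrite s2mE /= -!(inj_eq val_inj) /=; lia.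
  - by rewrite s2mE /= -!(inj_eq val_inj) /=; lia.
  - by rewrite mdeg_s2m /= leqNgt g4.
have [dE|dlt] := eqVneq (mdeg h) (mdeg g).
  have [p [t [pt gp gt]]] := lex_excess dE hg; exists t => //.
  rewrite inE g4 /=; apply/andP; split.
    by apply/existsP; exists p; rewrite pt -lt0n.
  by apply/implyP => /hlow ht; rewrite -leqn0 -ltnS (leq_trans gt).
have {dlt deg_hg} dlt : mdeg h < mdeg g by rewrite ltn_neqAle dlt.
case/generatorP: hG dlt {hg hlow}
  => [a b ra ab ->|i' j' l' ij' jr' jl' ->|i' j' ij' jr' ->].
- case/generatorP: gG g4 => [a' b' _ _ ->|i j l ij jr jl ->|i j ij jr ->];
    rewrite !mdeg_s2m //.
  move=> _ _; have [al|al] := eqVneq a l.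
    exists b.
      by rewrite colon_set_cubic // -!(inj_eq val_inj) /=; lia.
    by rewrite -al !s2mE /= -!(inj_eq val_inj) /=; lia.
  exists a.
    by rewrite colon_set_cubic // -!(inj_eq val_inj) /=; lia.
  by move: al; rewrite !s2mE /= -!(inj_eq val_inj) /=; lia.
- by rewrite mdeg_s2m /= => /(leq_ltn_trans _) => /(_ 3 isT); rewrite ltnNge -ltnS g4.
- by rewrite mdeg_s2m /= => /(leq_ltn_trans _) => /(_ 3 isT); rewrite ltnNge -ltnS g4.
Qed.

Lemma linear_quotients_generators :
  linear_quotients (sort <=%O (generators n r)) colon_set.
Proof.
apply: linear_quotients_sorted.
- by rewrite sort_lt_sorted generators_uniq.
- move=> g; rewrite mem_sort => /generatorP[a b _ _|i j l _ _ _|i j _ _] ->;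
  by rewrite mdeg_s2m.
- move=> g; rewrite mem_sort => gG t tg.
  by have [h [hG hg hgt]] := colon_set_sub gG tg; exists h; rewrite mem_sort.
- by move=> h g; rewrite !mem_sort; apply: colon_set_sup.
Qed.

End ColonSets.

(** * Counting generators by the size of their colon sets *)

Lemma sum_ord_interval n (P : pred nat) x y (F : nat -> nat) : y <= n ->
  (forall t, P t = (x < t <= y)) ->
  \sum_(t < n.+1 | P t) F t = \sum_(x.+1 <= t < y.+1) F t.
Proof.
move=> yn PE; rewrite (big_nat_widenl x.+1 0) // (big_nat_widen 0 y.+1 n.+1) //.
by rewrite big_mkord; apply: eq_bigl => t; rewrite PE.
Qed.

Lemma sum_nat_rev_shift x y (F : nat -> nat) :
  \sum_(x.+1 <= t < y.+1) F (y - t) = \sum_(0 <= c < y - x) F c.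
Proof.
have [xy|/ltnW yx] := leqP x y; last by rewrite big_geq // (eqP yx) big_geq.
rewrite -(subnKC xy); move: (y - x) => d; rewrite addKn.
elim: d x {xy} => [|d IHd] x; first by rewrite addn0 !big_geq.
rewrite big_ltn; last by lia.
rewrite [RHS]big_nat_recr //= addnC; congr (_ + _).
  by rewrite -(IHd x.+1) addSnnS.
by congr F; lia.
Qed.

(** The number of generators x_a x_b with n - a = c is c + 1; absorbing this factor
    into the binomial coefficient leaves a hockey-stick sum. *)
Lemma sum_succ_bin N q :
  \sum_(0 <= c < N) c.+1 * 'C(c, q) = 'C(N.+1, q.+2) * q.+1.
Proof.
elim: N => [|N IHN]; first by rewrite big_geq // bin_small.
by rewrite big_nat_recr //= IHN mul_bin_diag [_ * q.+1]mulnC -mulnDr mulnC -binS.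
Qed.

Section Counting.
Variables (n r : nat) (rn : r <= n).
Local Notation V := 'I_n.+1.
Local Notation colon_set := (@colon_set n r).

Lemma card_gt_ord (a : V) : #|[set t : V | a < t]| = n - a.
Proof.
rewrite -sum1_card (eq_bigl (fun t : V => a < t <= n)); last first.
  by move=> t; rewrite inE (leq_ord t) andbT.
rewrite (@sum_ord_interval n (fun t => a < t <= n) a n (fun=> 1)) //.
by rewrite sum_nat_const_nat muln1 subSS.
Qed.

Lemma card_colon_quadric (a b : V) : r < a -> a <= b ->
  #|colon_set (s2m [:: a; b])| = n - a.
Proof.
move=> ra ab; rewrite -card_gt_ord; apply: eq_card => t.
by rewrite colon_set_quadric // inE.
Qed.

Lemma card_colon_cubic (i j l : V) : i < j -> j <= r -> j < l ->
  #|colon_set (s2m [:: i; j; l])| = n - i - (if l <= r then 2 else 1).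
Proof.
move=> ij jr jl.
have := card_gt_ord i; rewrite (cardsD1 j) inE ij => cj.
have := cardsD1 l ([set t : V | i < t] :\ j); rewrite !inE (ltn_trans ij jl) andbT.
have -> : (l != j) by rewrite -(inj_eq val_inj) /= gtn_eqF.
move=> cl; case: leqP => lr.
  rewrite -cj cl addnA addnC addnK; apply: eq_card => t.
  rewrite colon_set_cubic // !inE -!(inj_eq val_inj) /=; lia.
rewrite -cj addnC addnK; apply: eq_card => t.
rewrite colon_set_cubic // !inE -!(inj_eq val_inj) /=; lia.
Qed.

Lemma card_colon_quartic (i j : V) : i < j -> j <= r ->
  #|colon_set (s2m [:: i; i; j; j])| = n - 1.
Proof.
move=> ij jr; have := cardsD1 j (~: [set i]); rewrite cardsC1 card_ord !inE /=.
have -> : (j != i) by rewrite -(inj_eq val_inj) /= gtn_eqF.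
move=> nE; rewrite [X in _ = X - 1]nE add1n subn1; apply: eq_card => t.
by rewrite colon_set_quartic // !inE andbC.
Qed.

Lemma sum_low_pairs (F : nat -> nat -> nat) :
  \sum_(p : V * V | p.1 < p.2 <= r) F p.1 p.2 =
  \sum_(0 <= i < r) \sum_(i.+1 <= j < r.+1) F i j.
Proof.
rewrite -(pair_big_dep xpredT (fun i j : V => i < j <= r) (fun i j : V => F i j)) /=.
under eq_bigr => i _ do
  rewrite (@sum_ord_interval n (fun j => i < j <= r) i r (F i)) //.
rewrite -(big_mkord xpredT (fun i => \sum_(i.+1 <= j < r.+1) F i j)).
rewrite (big_cat_nat (leq0n r)) /=; last exact: leqW.
rewrite [X in _ + X]big_nat_cond [X in _ + X]big1 ?addn0 // => i /andP[/andP[ri _] _].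
by rewrite big_geq.
Qed.

Variable Phi : nat -> nat -> nat.

Lemma sum_quadrics :
  \sum_(s <- quadric_words n r) Phi (size s) #|colon_set (s2m s)| =
  \sum_(0 <= c < n - r) c.+1 * Phi 2 c.
Proof.
rewrite big_map big_enum_cond /=.
rewrite (eq_bigl (fun p : V * V => (r < p.1) && (p.1 <= p.2)));
  last by move=> p; rewrite inE andbT.
rewrite (eq_bigr (fun p : V * V => Phi 2 (n - p.1))); last first.
  by move=> p /andP[ra ab]; rewrite card_colon_quadric.
rewrite -(pair_big_dep (fun a : V => r < a) (fun a b : V => a <= b)
  (fun a b : V => Phi 2 (n - a))) /=.
rewrite (eq_bigr (fun a : V => (n - a).+1 * Phi 2 (n - a))) => [|a ra]; last first.
  rewrite (bigD1 a) //= mulSn; congr (_ + _).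
  rewrite (eq_bigl (fun b : V => a < b <= n)) => [|b]; last first.
    by rewrite (leq_ord b) andbT -(inj_eq val_inj) /= andbC eq_sym -ltn_neqAle.
  rewrite (@sum_ord_interval n (fun b => a < b <= n) a n (fun=> _)) //.
  by rewrite sum_nat_const_nat subSS.
rewrite (eq_bigl (fun a : V => r < a <= n));
  last by move=> a; rewrite (leq_ord a) andbT.
rewrite (@sum_ord_interval n (fun a => r < a <= n) r n
  (fun a => (n - a).+1 * Phi 2 (n - a))) //.
exact: (sum_nat_rev_shift r n (fun c => c.+1 * Phi 2 c)).
Qed.

(** For i < j <= r there are n - r cubics x_i x_j x_l with l > r and r - j with
    l <= r; in the second case S(g) loses the variable x_l. *)
Lemma sum_cubics :
  \sum_(s <- cubic_words n r) Phi (size s) #|colon_set (s2m s)| =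
  (n - r) * (\sum_(0 <= i < r) (r - i) * Phi 3 (n - i - 1)) +
  \sum_(0 <= i < r - 1) 'C(r - i, 2) * Phi 3 (n - i - 2).
Proof.
pose G i j := (n - r) * Phi 3 (n - i - 1) + (r - j) * Phi 3 (n - i - 2).
rewrite big_map big_enum_cond /=.
rewrite (eq_bigl (fun p : V * V * V => (p.1.1 < p.1.2 <= r) && (p.1.2 < p.2)));
  last by move=> p; rewrite inE andbT.
rewrite (eq_bigr (fun p : V * V * V =>
  Phi 3 (n - p.1.1 - (if p.2 <= r then 2 else 1))));
  last by move=> p /andP[/andP[ij jr] jl]; rewrite card_colon_cubic.
rewrite -(pair_big_dep (fun p : V * V => p.1 < p.2 <= r)
  (fun (p : V * V) (l : V) => p.2 < l)
  (fun (p : V * V) (l : V) => Phi 3 (n - p.1 - (if l <= r then 2 else 1)))) /=.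
rewrite (eq_bigr (fun p : V * V => G p.1 p.2)) => [|[i j] /= /andP[ij jr]]; last first.
  rewrite (bigID (fun l : V => r < l)) /=; congr (_ + _).
    rewrite (eq_bigl (fun l : V => r < l <= n)) => [|l]; last first.
      by rewrite (leq_ord l) andbT; lia.
    rewrite (eq_bigr (fun _ => Phi 3 (n - i - 1))) => [|l];
      last by case/andP; case: leqP.
    rewrite (@sum_ord_interval n (fun l => r < l <= n) r n (fun=> _)) //.
    by rewrite sum_nat_const_nat subSS.
  rewrite (eq_bigl (fun l : V => j < l <= r)) => [|l]; last by rewrite -leqNgt.
  rewrite (eq_bigr (fun _ => Phi 3 (n - i - 2))) => [|l /andP[_ ->]//].
  rewrite (@sum_ord_interval n (fun l => j < l <= r) j r (fun=> _)) //.
  by rewrite sum_nat_const_nat subSS.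
rewrite sum_low_pairs /G.
under eq_bigr => i _ do rewrite big_split /= sum_nat_const_nat subSS -big_distrl /=
  (sum_nat_rev_shift i r id) bin2_sum.
rewrite big_split /= big_distrr /=; congr (_ + _).
  by apply: eq_bigr => i _; rewrite mulnCA.
case: r rn => [|r'] _; first by rewrite !big_geq.
by rewrite big_nat_recr //= subSnn bin_small // mul0n addn0 subn1.
Qed.

Lemma sum_quartics :
  \sum_(s <- quartic_words n r) Phi (size s) #|colon_set (s2m s)| =
  'C(r + 1, 2) * Phi 4 (n - 1).
Proof.
rewrite big_map big_enum_cond /=.
rewrite (eq_bigl (fun p : V * V => p.1 < p.2 <= r)); last by move=> p; rewrite inE andbT.
rewrite (eq_bigr (fun p : V * V => Phi 4 (n - 1))); last first.
  by move=> p /andP[ij jr]; rewrite card_colon_quartic.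
rewrite (sum_low_pairs (fun _ _ => _)).
under eq_bigr => i _ do rewrite sum_nat_const_nat subSS.
rewrite -big_distrl /=; congr (_ * _).
rewrite addn1 -bin2_sum big_nat_recl //= add0n.
have := sum_nat_rev_shift 0 r succn; rewrite subn0 => <-.
rewrite big_add1 /= big_nat_cond [RHS]big_nat_cond.
by apply: eq_bigr => i; rewrite andbT => /andP[_ ir]; rewrite subnSK.
Qed.

Lemma sum_generators :
  \sum_(g <- generators n r) Phi (mdeg g) #|colon_set g| =
  \sum_(0 <= c < n - r) c.+1 * Phi 2 c +
  ((n - r) * (\sum_(0 <= i < r) (r - i) * Phi 3 (n - i - 1)) +
   \sum_(0 <= i < r - 1) 'C(r - i, 2) * Phi 3 (n - i - 2) +
   'C(r + 1, 2) * Phi 4 (n - 1)).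
Proof.
rewrite big_map (eq_bigr (fun s => Phi (size s) #|colon_set (s2m s)|)); last first.
  by move=> s _; rewrite mdeg_s2m.
by rewrite !big_cat /= sum_quadrics sum_cubics sum_quartics.
Qed.

End Counting.

Local Open Scope ring_scope.

(** * The Betti numbers of double points *)

(** Independent points are the first vectors of a basis: in the decomposition of P
    by Gaussian elimination, replace the first rows of the invertible right factor
    by P. *)
Lemma complete_rows (k : fieldType) p d (P : 'M[k]_(p, p + d)) : row_free P ->
  exists2 A : 'M_(p + d), A \in unitmx & usubmx A = P.
Proof.
move=> /eqP rP; pose E := row_ebase P.
exists (col_mx P (dsubmx E)); last by rewrite col_mxKu.
have PE : P = col_ebase P *m usubmx E.
  rewrite -[LHS]mulmx_ebase rP -mulmxA; congr (_ *m _).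
  rewrite pid_mx_row -{1}[row_ebase P]vsubmxK mul_row_col mul1mx mul0mx addr0.
  by [].
have -> : col_mx P (dsubmx E) = block_mx (col_ebase P) 0 0 1%:M *m E.
  rewrite -[in RHS](vsubmxK E) mul_block_col !mul0mx mul1mx addr0 add0r.
  by rewrite -PE.
by rewrite unitmx_mul row_ebase_unit unitmxE det_ublock
  det1 mulr1 -unitmxE col_ebase_unit.
Qed.

Section DoublePoints.
Variables (k : fieldType) (n r : nat) (rn : (r <= n)%N).
Variables (P : 'M[k]_(r.+1, n.+1)) (A : 'M[k]_n.+1).
Hypotheses (A_unit : A \in unitmx).
Hypothesis PA : forall i j, P i j = A (widen_ord (rn : r < n.+1)%N i) j.
Local Notation R := {mpoly k[n.+1]}.
Local Notation gens := (sort <=%O (generators n r)).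

Lemma double_points_idealE (f : R) :
  phi_mon_ideal (lin_subst A) gens f <-> f \in double_points_ideal P.
Proof.
have Pi i : (P i : 'I_n.+1 -> k) = A (widen_ord (rn : r < n.+1)%N i).
  by apply: funext => j; apply: PA.
have sortE u : multiple_of gens u = multiple_of (generators n r) u.
  by apply: eq_has_r => g; rewrite mem_sort.
split=> [fG|/asboolP fP u uf].
  apply/asboolP => i; rewrite Pi; apply/(double_point_idealE A_unit) => u /fG.
  by rewrite sortE => /multiple_of_generators; apply; rewrite /= -ltnS.
rewrite sortE; apply/multiple_of_generators => i ir.
have := fP (Ordinal (ir : (i < r.+1)%N)); rewrite Pi => /(double_point_idealE A_unit).
by move=> /(_ u uf); rewrite (_ : widen_ord _ _ = i) //; apply: val_inj.
Qed.

Lemma double_points_betti q j :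
  quot_betti (double_points_ideal P) q j (lq_betti gens (@colon_set n r) q j).
Proof.
split=> [|F eps res]; first exact: resolution_exists.
apply: homology_dim_quot; apply: (hdim_iff double_points_idealE).
have phiK : cancel (lin_subst (invmx A)) (lin_subst A).
  by apply: lin_substK; rewrite mulmxV.
have psiK : cancel (lin_subst A) (lin_subst (invmx A)).
  by apply: lin_substK; rewrite mulVmx.
apply: (hdim_linear_quotients res phiK psiK).
- exact: lin_subst_homog.
- exact: lin_subst_homog.
- exact: linear_quotients_generators.
Qed.

Lemma lq_betti_generators q j : lq_betti gens (@colon_set n r) q.+1 j =
  ((j == (2 + q)%N%:Z) * ('C(n - r + 1, q.+2) * q.+1) +
   (j == (3 + q)%N%:Z) *
     ((n - r) * (\sum_(0 <= i < r) (r - i) * 'C(n - i - 1, q)) +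
      \sum_(0 <= i < r - 1) 'C(r - i, 2) * 'C(n - i - 2, q)) +
   (j == (4 + q)%N%:Z) * ('C(r + 1, 2) * 'C(n - 1, q)))%N.
Proof.
have pull (c : bool) N (f g : nat -> nat) :
    (\sum_(0 <= i < N) f i * (c * g i) = c * \sum_(0 <= i < N) f i * g i)%N.
  by rewrite big_distrr /=; apply: eq_bigr => i _; rewrite mulnCA.
rewrite /lq_betti (perm_big (generators n r)) /=; last by rewrite perm_sort.
rewrite (sum_generators rn (fun d c => (j == (d + q)%N%:Z) * 'C(c, q))%N).
rewrite !pull sum_succ_bin !addn1 addnA; congr (_ + _ + _)%N; last by rewrite mulnCA.
by rewrite [in LHS]mulnCA -mulnDr.
Qed.

End DoublePoints.

Theorem proposition3p2 (k : fieldType) (n r : nat) (hrn : (r <= n)%N)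
    (P : 'M[k]_(r.+1, n.+1)) (hP : row_free P) :
  [/\ (forall q : nat, (1 <= q)%N ->
         [/\ quot_betti (double_points_ideal P) q (q + 1)%N%:Z
               ('C(n - r + 1, q + 1) * 'C(q, q - 1))%N,
             quot_betti (double_points_ideal P) q (q + 2)%N%:Z
               ((n - r) * (\sum_(0 <= i < r) (r - i) * 'C(n - i - 1, q - 1)) +
                \sum_(0 <= i < r - 1) 'C(r - i, 2) * 'C(n - i - 2, q - 1))%N,
             quot_betti (double_points_ideal P) q (q + 3)%N%:Z
               ('C(r + 1, 2) * 'C(n - 1, q - 1))%N
           & forall j : int,
               j != (q + 1)%N%:Z -> j != (q + 2)%N%:Z -> j != (q + 3)%N%:Z ->
               quot_betti (double_points_ideal P) q j 0]),
      quot_betti (double_points_ideal P) 0 0 1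
    & forall j : int, j != 0 ->
        quot_betti (double_points_ideal P) 0 j 0].
Proof.
have [A A_unit PA] : exists2 A : 'M[k]_n.+1, A \in unitmx &
    forall i j, P i j = A (widen_ord (hrn : r < n.+1)%N i) j.
  move: (hrn) P hP; rewrite -(subnKC hrn) => hrn' {}P {}hP.
  have [A A_unit <-] := complete_rows (hP : row_free (P : 'M_(r.+1, r.+1 + _))).
  exists A => // i j; rewrite mxE; congr (A _ j); exact: val_inj.
have betti := double_points_betti A_unit PA.
split=> [[//|q] _||j j0].
- have Bq j b : lq_betti (sort <=%O (generators n r)) (@colon_set n r) q.+1 j = b ->
      quot_betti (double_points_ideal P) q.+1 j b by move=> <-; apply: betti.
  have E j := lq_betti_generators hrn q j.
  rewrite subn1 /= binSn; split=> [|||j j1 j2 j3]; apply: Bq; rewrite E.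
  + have -> : ((q.+1 + 1)%N%:Z == (2 + q)%N%:Z) by lia.
    have -> : ((q.+1 + 1)%N%:Z == (3 + q)%N%:Z) = false by lia.
    have -> : ((q.+1 + 1)%N%:Z == (4 + q)%N%:Z) = false by lia.
    by rewrite /= !mul0n mul1n !addn0 [(q.+1 + 1)%N]addn1.
  + have -> : ((q.+1 + 2)%N%:Z == (2 + q)%N%:Z) = false by lia.
    have -> : ((q.+1 + 2)%N%:Z == (3 + q)%N%:Z) by lia.
    have -> : ((q.+1 + 2)%N%:Z == (4 + q)%N%:Z) = false by lia.
    by rewrite /= !mul0n mul1n addn0 add0n.
  + have -> : ((q.+1 + 3)%N%:Z == (2 + q)%N%:Z) = false by lia.
    have -> : ((q.+1 + 3)%N%:Z == (3 + q)%N%:Z) = false by lia.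
    have -> : ((q.+1 + 3)%N%:Z == (4 + q)%N%:Z) by lia.
    by rewrite /= !mul0n mul1n add0n.
  + have -> : (2 + q = q.+1 + 1)%N by lia.
    have -> : (3 + q = q.+1 + 2)%N by lia.
    have -> : (4 + q = q.+1 + 3)%N by lia.
    by rewrite (negbTE j1) (negbTE j2) (negbTE j3).
- exact: betti 0%N 0.
- by have := betti 0%N j; rewrite /= (negbTE j0).
Qed.
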